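(* Let $0<\alpha\le1$, let $\{\mathcal{S}^\alpha(t)\}_{t\ge0}$ be the generalized fractional Skellam process with rates $\lambda_j,\mu_j>0$, $j=1,\dots,k$, and let $\{D_f(t)\}_{t\ge0}$ be an independent Lévy subordinator with $\mathbb{E}(D_f^r(t))<\infty$ for all $r>0$. Let $\mathcal{Z}_f^\alpha(t)=\mathcal{S}^\alpha(D_f(t))$. Then its probability generating function $G_f^\alpha(u,t)=\mathbb{E}(u^{\mathcal{Z}_f^\alpha(t)})$ is given by $$G_f^\alpha(u,t)=\sum_{n=0}^{\infty}\frac{\Big(\sum_{j=1}^{k}\big(\lambda_j(u^j-1)+\mu_j(u^{-j}-1)\big)\Big)^n}{\Gamma(n\alpha+1)}\,\mathbb{E}\big((D_f(t))^{n\alpha}\big),\qquad |u|\le1.$$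
   Context: Fix an integer $k\ge1$ and positive rates $\lambda_1,\dots,\lambda_k,\mu_1,\dots,\mu_k$. The generalized counting process (GCP) with rates $\lambda_1,\dots,\lambda_k$ is a Lévy process started at $0$ performing jumps of size $j\in\{1,\dots,k\}$ at rate $\lambda_j$. The generalized Skellam process (GSP) is $\mathcal{S}(t)=M_1(t)-M_2(t)$, with $M_1,M_2$ independent GCPs with rates $\lambda_j$ and $\mu_j$, respectively. For $0<\alpha<1$, the inverse stable subordinator is $Y_\alpha(t)=\inf\{x\ge0: D_\alpha(x)>t\}$, where $D_\alpha$ is the stable subordinator, $\mathbb{E}(e^{-sD_\alpha(t)})=e^{-ts^\alpha}$. The generalized fractional Skellam process (GFSP) is $\mathcal{S}^\alpha(t)=\mathcal{S}(Y_\alpha(t))$ for $0<\alpha<1$ with $\mathcal{S}$ and $Y_\alpha$ independent, and $\mathcal{S}^1(t)=\mathcal{S}(t)$. A Lévy subordinator $\{D_f(t)\}_{t\ge0}$ is a one-dimensional Lévy process with non-decreasing sample paths, $D_f(0)=0$ a.s., and $\mathbb{E}(e^{-sD_f(t)})=e^{-tf(s)}$, $s>0$, where $f$ is its Bernštein function. The process $\mathcal{Z}_f^\alpha$ is called the time-changed generalized fractional Skellam process-I (TCGFSP-I).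
   Formalization: The identity is stated for u ≠ 0 with E(|u|^Z) finite and the series on the right convergent (not necessarily absolutely); without this it can fail, e.g. α=1, k=1, λ=10, μ=1, u=1/2, D_f gamma with D_f(1) exponential: left side 1/5, right side Σ(-4)^n. *)

(* Defs.v *)
From HB Require Import structures.
From mathcomp Require Import all_boot all_order all_algebra.
From mathcomp Require Import all_classical all_reals all_analysis.
From mathcomp Require Import complex.

Set Implicit Arguments.
Unset Strict Implicit.
Unset Printing Implicit Defensive.

Import Order.TTheory GRing.Theory Num.Theory.
Import numFieldNormedType.Exports.

Local Open Scope classical_set_scope.
Local Open Scope ring_scope.

(* R[i] seen as a numFieldType, so that it carries the topology of its norm. *)
Definition cplx (R : realType) : numFieldType := R[i].

Definition Gamma (R : realType) (x : R) : R :=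
  Rintegral lebesgue_measure `]0, +oo[ (fun t : R => t `^ (x - 1) * expR (- t)).

Definition bernstein (R : realType) (f : R -> R) : Prop :=
  forall s : R, 0 < s ->
    [/\ forall n : nat, derivable (derive1n n f) s 1,
        0 <= f s
      & forall n : nat, 0 <= (-1) ^+ n * derive1n n.+1 f s].

(* Throughout, a process X : R -> T -> V indexed by time is only meaningful at
   times t >= 0; its values at negative times are ignored. *)
Section processes.
Context (d : measure_display) (T : measurableType d) (R : realType)
        (P : probability T R).

Definition cadlag (x : R -> R) : Prop :=
  (forall t, 0 <= t -> x s @[s --> t^'+] --> x t) /\
  (forall t, 0 < t -> cvg (x s @[s --> t^'-])).

Definition process_sigma (X : R -> T -> R) : set (set T) :=
  <<s [set A | exists t (B : set R),
         [/\ 0 <= t, measurable B & A = X t @^-1` B]] >>.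

Definition independent_processes (X Y : R -> T -> R) : Prop :=
  forall A B : set T, process_sigma X A -> process_sigma Y B ->
    P (A `&` B) = (P A * P B)%E.

(* The product rule over all n increments also covers subfamilies, since some
   of the B i may be taken to be setT. *)
Definition independent_increments (X : R -> T -> R) : Prop :=
  forall (n : nat) (t : nat -> R) (B : 'I_n -> set R),
    0 <= t 0%N -> (forall i, t i < t i.+1) -> (forall i, measurable (B i)) ->
    P [set w | forall i : 'I_n, B i (X (t i.+1) w - X (t i) w)] =
    (\prod_(i < n) P [set w | B i (X (t i.+1) w - X (t i) w)%R])%E.

Definition stationary_increments (X : R -> T -> R) : Prop :=
  forall (s h : R) (B : set R), 0 <= s -> 0 <= h -> measurable B ->
    P [set w | B (X (s + h) w - X s w)] = P [set w | B (X h w)].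

(* Stochastic continuity follows from cadlag paths and stationarity. *)
Definition levy_process (X : R -> T -> R) : Prop :=
  [/\ forall t, 0 <= t -> measurable_fun setT (X t),
      {ae P, forall w, X 0 w = 0},
      independent_increments X,
      stationary_increments X
    & forall w, cadlag (X ^~ w)].

(* The jump rates are expressed by the infinitesimal transition probabilities
   P(M(h) = j) = lam_j h + o(h) for 1 <= j <= k and
   P(M(h) = 0) = 1 - (lam_1 + ... + lam_k) h + o(h);
   the rate of jumps of size j is lam (j - 1), the index running in 'I_k. *)
Definition gcp (k : nat) (lam : 'I_k -> R) (M : R -> T -> nat) : Prop :=
  [/\ levy_process (fun t w => (M t w)%:R),
      forall j : 'I_k,
        fine (P [set w | M h w = j.+1]) / h @[h --> 0^'+] --> lam j
    & (1 - fine (P [set w | M h w = 0%N])) / h @[h --> 0^'+]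
        --> \sum_(j < k) lam j].

Definition gsp (k : nat) (lam mu : 'I_k -> R) (S : R -> T -> int) : Prop :=
  exists M1 M2 : R -> T -> nat,
    [/\ gcp lam M1, gcp mu M2,
        independent_processes (fun t w => (M1 t w)%:R) (fun t w => (M2 t w)%:R)
      & forall t w, 0 <= t -> S t w = (M1 t w)%:Z - (M2 t w)%:Z].

Definition levy_subordinator (f : R -> R) (D : R -> T -> R) : Prop :=
  [/\ bernstein f,
      levy_process D,
      forall w s t, 0 <= s -> s <= t -> 0 <= D s w /\ D s w <= D t w
    & forall s t, 0 < s -> 0 <= t ->
        'E_P[fun w => expR (- s * D t w)%R]%E = (expR (- t * f s))%:E].

Definition stable_subordinator (alpha : R) (D : R -> T -> R) : Prop :=
  levy_subordinator (fun s => s `^ alpha) D.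

Definition inverse_process (D : R -> T -> R) (t : R) (w : T) : R :=
  inf [set x | 0 <= x /\ t < D x w].

Definition gfsp (alpha : R) (k : nat) (lam mu : 'I_k -> R)
    (Sa : R -> T -> int) : Prop :=
  exists2 S : R -> T -> int, gsp lam mu S &
    (alpha = 1 /\ forall t w, 0 <= t -> Sa t w = S t w) \/
    (0 < alpha < 1 /\
     exists Da : R -> T -> R,
       [/\ stable_subordinator alpha Da,
           independent_processes (fun t w => (S t w)%:~R) (inverse_process Da)
         & forall t w, 0 <= t -> Sa t w = S (inverse_process Da t w) w]).

Definition cexpectation (X : T -> cplx R) : cplx R :=
  Complex (fine 'E_P[fun w => complex.Re (X w)])
          (fine 'E_P[fun w => complex.Im (X w)]).

(* E(|u| ^ Z) < oo, i.e. the expectation defining pgf below exists. *)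
Definition pgf_exists (Z : T -> int) (u : cplx R) : Prop :=
  ('E_P[fun w => (complex.Re `|u| ^ Z w)%R] < +oo)%E.

Definition pgf (Z : T -> int) (u : cplx R) : cplx R :=
  cexpectation (fun w => u ^ Z w).

End processes.

Definition skellam_exponent (R : realType) (k : nat) (lam mu : 'I_k -> R)
    (u : cplx R) : cplx R :=
  \sum_(j < k) (real_complex R (lam j) * (u ^+ j.+1 - 1) +
                real_complex R (mu j) * (u ^- j.+1 - 1)).

(* Main.v *)
From HB Require Import structures.
Require Import Defs.
From mathcomp Require Import all_boot all_order all_algebra.
From mathcomp Require Import all_classical all_reals all_analysis.
From mathcomp Require Import measurable_realfun complex ring lra.

(** Let [psi = skellam_exponent lam mu u].  Cut [0, s] into [n] intervals and
    truncate the increments of a counting process to [0, k]: the truncated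
    increments are i.i.d. with a generating function [1 + z / n + o(1 / n)],
    whence E u^S(s) = exp(s psi); as only finite sums occur, this also holds for
    [u^-1].  Conditioning on the independent random time gives
    E u^Z = E exp(psi W), where W = D(t) if alpha = 1, and otherwise
    W = (D(t) / Da(1))^alpha for an independent copy of the stable subordinator
    Da: indeed Da(q) has the law of q^(1 / alpha) Da(1), because a Laplace
    transform determines the law.  Integrating exp(- x^(1 / alpha) Da(1)) against
    x^n gives E Da(1)^(- n alpha) = n! / Gamma(n alpha + 1), so that the n-th
    term of the series is psi^n E W^n / n!.

    Nothing ensures that E exp(|psi| W) is finite, so the sum cannot be exchanged
    with the expectation directly.  The exchange is legitimate for [r psi],
    [0 <= r < 1]; as [r] tends to 1 the series converges to its sum by Abel's
    theorem, and the expectations converge by dominated convergence, since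
    |exp(r psi W)| <= 1 + exp(kappa W), where exp(kappa W) is the conditional
    expectation of |u|^Z, integrable by hypothesis. *)

Set Implicit Arguments.
Unset Strict Implicit.
Unset Printing Implicit Defensive.
Import Order.TTheory GRing.Theory Num.Theory.
Import numFieldNormedType.Exports.
Import ComplexField.Normc.
Local Open Scope classical_set_scope.
Local Open Scope ring_scope.

(** Complex integrals are never formed: a real functional f, additive, homogeneous over the reals
    and bounded by the modulus, stands for [Re] or [Im], so that each limit or exchange is proved
    once, for real integrands. The rates control the probabilities P(M(h) = j) for j <= k only:
    larger jumps have mass o(h), but none of their moments is under control. Truncation therefore
    appears as a weight xi, the indicator that all n increments are at most k. The mean of v^M xi is
    explicit; capping r^M at N yields a bound for E r^M, r >= 0, and this bound at r = |v|^2 gives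
    the square integrability that removes the weight. In the fractional case nothing relates D and
    Da under P: independence is given for Sa and D, and for S and the inverse of Da. Conditioning
    twice leaves a double integral, so D(t) and Da(1) are placed on the two factors of P x P, and W
    is a function on that product. *)

Lemma squeeze_cvg0 (R : realType) (u v : nat -> R) :
  (\forall n \near \oo, `|u n| <= v n) -> v n @[n --> \oo] --> 0 ->
  u n @[n --> \oo] --> 0.
Proof.
move=> uv v0; apply/cvgrPdist_le => e e0.
move/cvgrPdist_le: v0 => /(_ _ e0) v0; near=> n.
rewrite sub0r normrN; apply: (@le_trans _ _ (v n)); first by near: n.
have : `|0 - v n| <= e by near: n.
by rewrite sub0r normrN; apply: le_trans; exact: ler_norm.
Unshelve. all: by end_near. Qed.

Lemma cvg_sub0 (R : realType) (u : nat -> R) (l : R) :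
  u n @[n --> \oo] --> l -> u n - l @[n --> \oo] --> 0.
Proof. by move=> ul; rewrite -(subrr l); apply: cvgB => //; exact: cvg_cst. Qed.

(** * The complex exponential, handled through real and imaginary parts *)

Section complex_exponential.
Local Open Scope complex_scope.
Local Open Scope ring_scope.
Variable R : realType.
Implicit Types z w a b : R[i].
Local Notation Re := complex.Re.
Local Notation Im := complex.Im.

Definition cexp z : R[i] :=
  Complex (expR (Re z) * cos (Im z)) (expR (Re z) * sin (Im z)).

Lemma ReD z w : Re (z + w) = Re z + Re w. Proof. by case: z w => ? ? []. Qed.
Lemma ImD z w : Im (z + w) = Im z + Im w. Proof. by case: z w => ? ? []. Qed.
Lemma ReB z w : Re (z - w) = Re z - Re w. Proof. by case: z w => ? ? []. Qed.
Lemma ImB z w : Im (z - w) = Im z - Im w. Proof. by case: z w => ? ? []. Qed.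

Lemma Re_sum I (r : seq I) (p : pred I) (F : I -> R[i]) :
  Re (\sum_(i <- r | p i) F i) = \sum_(i <- r | p i) Re (F i).
Proof. exact: (big_morph _ ReD). Qed.

Lemma Im_sum I (r : seq I) (p : pred I) (F : I -> R[i]) :
  Im (\sum_(i <- r | p i) F i) = \sum_(i <- r | p i) Im (F i).
Proof. exact: (big_morph _ ImD). Qed.

Lemma Re_mulrC z (c : R) : Re (z * c%:C) = Re z * c.
Proof. by case: z => x y /=; rewrite mulr0 subr0. Qed.

Lemma Im_mulrC z (c : R) : Im (z * c%:C) = Im z * c.
Proof. by case: z => x y /=; rewrite mulr0 add0r. Qed.

Lemma normc_ge0 z : 0 <= normc z.
Proof. by case: z => x y; exact: sqrtr_ge0. Qed.

Lemma le_Re_normc z : `|Re z| <= normc z.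
Proof.
case: z => x y /=; rewrite -sqrtr_sqr ler_sqrt ?lerDl ?sqr_ge0//.
by rewrite addr_ge0 ?sqr_ge0.
Qed.

Lemma le_Im_normc z : `|Im z| <= normc z.
Proof.
case: z => x y /=; rewrite -sqrtr_sqr ler_sqrt ?lerDr ?sqr_ge0//.
by rewrite addr_ge0 ?sqr_ge0.
Qed.

Lemma normc_real (x : R) : normc x%:C = `|x|.
Proof. by rewrite /normc /= expr0n/= addr0 sqrtr_sqr. Qed.

Lemma ler_normcD z w : normc (z + w) <= normc z + normc w.
Proof. exact: le_normcD. Qed.

Lemma normc_le_ReIm z : normc z <= `|Re z| + `|Im z|.
Proof.
have {1}-> : z = (Re z)%:C + (Im z)%:C * Complex 0 1.
  by case: z => x y /=; apply/eqP; rewrite eq_complex /=; apply/andP; split;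
    apply/eqP; ring.
apply: le_trans (ler_normcD _ _) _; rewrite normcM !normc_real lerD2l.
by rewrite /normc /= expr0n/= add0r expr1n sqrtr1 mulr1.
Qed.

Lemma normcX z n : normc (z ^+ n) = normc z ^+ n.
Proof. by elim: n => [|n IH]; rewrite ?expr0 ?normc1// !exprS normcM IH. Qed.

Lemma normc_sum I (r : seq I) (p : pred I) (F : I -> R[i]) :
  normc (\sum_(i <- r | p i) F i) <= \sum_(i <- r | p i) normc (F i).
Proof.
elim/big_ind2: _ => //; first by rewrite normc0.
by move=> x1 x2 y1 y2 h1 h2; rewrite (le_trans (ler_normcD _ _))// lerD.
Qed.

Lemma normc_cexp z : normc (cexp z) = expR (Re z).
Proof.
rewrite /normc /= !exprMn -mulrDr cos2Dsin2 mulr1 sqrtr_sqr.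
by rewrite ger0_norm// expR_ge0.
Qed.

Lemma cexp0 : cexp 0 = 1.
Proof. by rewrite /cexp /= expR0 cos0 sin0 !mul1r. Qed.

Lemma cexpD z w : cexp (z + w) = cexp z * cexp w.
Proof.
apply/eqP; rewrite eq_complex /= ReD ImD expRD cosD sinD.
by apply/andP; split; apply/eqP; ring.
Qed.

Lemma cexpMn z n : cexp (z *+ n) = cexp z ^+ n.
Proof. by elim: n => [|n IH]; rewrite ?cexp0// mulrS cexpD IH exprS. Qed.

Lemma cexp_real (x : R) : cexp x%:C = (expR x)%:C.
Proof. by rewrite /cexp /= cos0 sin0 mulr1 mulr0. Qed.

(** The factorization of a^n - b^n by a - b leaves n terms of modulus at most rho^(n-1), which is at
    most rho^n because rho >= 1. *)
Lemma normc_subX a b (rho : R) n : normc a <= rho -> normc b <= rho ->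
  1 <= rho -> normc (a ^+ n - b ^+ n) <= rho ^+ n * (n%:R * normc (a - b)).
Proof.
move=> ha hb h1; rewrite subrXX normcM mulrC mulrA ler_wpM2r ?normc_ge0//.
rewrite (le_trans (normc_sum _ _ _))//.
have -> : rho ^+ n * n%:R = \sum_(i < n) rho ^+ n.
  by rewrite sumr_const card_ord mulr_natr.
apply: ler_sum => i _; rewrite normcM !normcX.
have ? := normc_ge0 a; have ? := normc_ge0 b.
have ? : 0 <= rho by rewrite (le_trans _ h1).
apply: (@le_trans _ _ (rho ^+ (n.-1 - i) * rho ^+ i)).
  by apply: ler_pM => //; rewrite ?exprn_ge0 ?lerXn2r ?nnegrE.
by rewrite -exprD ler_weXn2l// subnK ?leq_pred// -ltnS prednK//
  (leq_ltn_trans _ (ltn_ord i)).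
Qed.

Lemma cvg_normc0 (u : nat -> R[i]) :
  Re (u n) @[n --> \oo] --> 0 -> Im (u n) @[n --> \oo] --> 0 ->
  normc (u n) @[n --> \oo] --> 0.
Proof.
move=> hR hI.
apply: (@squeeze_cvg0 _ _ (fun n => `|Re (u n)| + `|Im (u n)|)).
  by apply: nearW => n; rewrite ger0_norm ?normc_ge0// normc_le_ReIm.
rewrite -[X in _ --> X](addr0 0); apply: cvgD.
- by rewrite -(normr0 R); apply: (cvg_norm hR).
- by rewrite -(normr0 R); apply: (cvg_norm hI).
Qed.

Lemma cvg_Re_normc (u : nat -> R[i]) z : normc (u n - z) @[n --> \oo] --> 0 ->
  Re (u n) @[n --> \oo] --> Re z.
Proof.
move=> h; apply/cvgrPdist_le => e e0.
move/cvgrPdist_le: h => /(_ _ e0); apply: filterS => n.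
rewrite sub0r normrN ger0_norm ?normc_ge0// => /(le_trans _); apply.
by rewrite distrC -ReB le_Re_normc.
Qed.

Lemma cvg_Im_normc (u : nat -> R[i]) z : normc (u n - z) @[n --> \oo] --> 0 ->
  Im (u n) @[n --> \oo] --> Im z.
Proof.
move=> h; apply/cvgrPdist_le => e e0.
move/cvgrPdist_le: h => /(_ _ e0); apply: filterS => n.
rewrite sub0r normrN ger0_norm ?normc_ge0// => /(le_trans _); apply.
by rewrite distrC -ImB le_Im_normc.
Qed.

Lemma cvg_nmul_derive0 (f : R -> R) (l : R) : is_derive (0 : R) (1 : R) f l ->
  n%:R * (f n%:R^-1 - f 0) @[n --> \oo] --> l.
Proof.
move=> [df <-].
have h : h^-1 *: (f (h *: 1 + 0) - f 0) @[h --> 0^'] --> 'D_1 f 0.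
  have := df; rewrite /derivable /derive => /cvgP.
  by under eq_fun do rewrite /=.
have hn : ((n.+1%:R : R)^-1) @[n --> \oo] --> (0 : R)^'.
  move=> A [e/= e0 he].
  have [N _ hN] := cvgr0_norm_lt _ (@cvg_harmonic R) e e0.
  exists N => // n /= Nn; apply: he; rewrite /= ?sub0r ?normrN.
    exact: hN.
  by rewrite invr_eq0.
have := cvg_comp _ _ hn h.
rewrite -(cvg_shiftS (fun n => n%:R * (f n%:R^-1 - f 0))).
apply: cvg_trans; apply: near_eq_cvg; near=> n.
by rewrite /= invrK -[_ *: 1]/(_ * 1) mulr1 addr0.
Unshelve. all: by end_near. Qed.

Lemma cvg_nmul_cexp z :
  normc (n%:R * (cexp (z * (n%:R^-1)%:C) - 1) - z) @[n --> \oo] --> 0.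
Proof.
have nRe n w : Re (n%:R * w) = n%:R * Re w by rewrite
  -(rmorph_nat (real_complex R)) mulrC Re_mulrC mulrC.
have nIm n w : Im (n%:R * w) = n%:R * Im w by rewrite
  -(rmorph_nat (real_complex R)) mulrC Im_mulrC mulrC.
apply: cvg_normc0.
- have h : is_derive (0:R) (1:R) (fun t : R => expR (Re z * t) * cos (Im z * t))
    (Re z).
    apply: is_derive_eq; rewrite !mulr0 expR0 cos0 sin0 /= ?scaler0 ?mul1r.
    by rewrite /GRing.scale /=; ring.
  have /cvg_sub0 := cvg_nmul_derive0 h; apply: cvg_trans.
  apply: near_eq_cvg; near=> n => /=.
  by rewrite ReB nRe ReB /= !Re_mulrC Im_mulrC !mulr0 expR0 cos0 mulr1.
- have h : is_derive (0:R) (1:R) (fun t : R => expR (Re z * t) * sin (Im z * t))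
    (Im z).
    apply: is_derive_eq; rewrite !mulr0 expR0 cos0 sin0 /= ?scaler0 ?mul1r.
    by rewrite /GRing.scale /=; ring.
  have /cvg_sub0 := cvg_nmul_derive0 h; apply: cvg_trans.
  apply: near_eq_cvg; near=> n => /=.
  by rewrite ImB nIm ImB /= Re_mulrC !Im_mulrC !mulr0 expR0 sin0 mulr0 subr0.
Unshelve. all: by end_near. Qed.

End complex_exponential.

(** * Exponential limits and power series *)

Section exponential_limits.
Variable R : realType.
Local Open Scope complex_scope.
Local Open Scope ring_scope.
Implicit Types z : R[i].
Local Notation Re := complex.Re.
Local Notation Im := complex.Im.

Lemma normc_natmul n z : normc (n%:R * z) = n%:R * normc z.
Proof. by rewrite normcM -(rmorph_nat (real_complex R)) normc_real normr_nat.
  Qed.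

(** No complex logarithm is taken: a_n is compared, through [normc_subX], with b_n = exp(z / n),
    whose n-th power is exactly exp(z); both n (a_n - 1) and n (b_n - 1) tend to z. *)
Lemma cvg_cexpX (a : nat -> R[i]) z :
  normc (n%:R * (a n - 1) - z) @[n --> \oo] --> 0 ->
  normc (a n ^+ n - cexp z) @[n --> \oo] --> 0.
Proof.
move=> ha; pose b n := cexp (z * (n%:R^-1)%:C).
(* Once n (a_n - 1) is within 1 of z, both |a_n| and |b_n| are at most exp(C / n), and the n-th
   power of this bound is the constant exp(C). *)
pose C := normc z + 1.
have C0 : 0 <= C by rewrite addr_ge0 ?normc_ge0.
apply: (@squeeze_cvg0 _ _ (fun n => expR C *
   (normc (n%:R * (a n - 1) - z) + normc (n%:R * (b n - 1) - z)))).
  near=> n.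
  have n0 : (0 < n)%N by near: n; exists 1%N.
  have n0' : (0 : R) < n%:R by rewrite ltr0n.
  have bn : b n ^+ n = cexp z.
    rewrite -cexpMn -mulrnAr; congr cexp.
    by rewrite -[in X in _ * X]mulr_natr -(rmorph_nat (real_complex R)) -rmorphM
      mulVf ?gt_eqF// mulr1.
  have hC : normc (n%:R * (a n - 1) - z) <= 1.
    near: n; move/cvgrPdist_le : ha => /(_ _ ltr01); apply: filterS => n.
    by rewrite sub0r normrN ger0_norm ?normc_ge0.
  rewrite ger0_norm ?normc_ge0// -bn.
  have e1 (w : R[i]) : normc w <= C / n%:R -> normc (1 + w) <= expR (C / n%:R).
    move=> h; apply: le_trans (ler_normcD _ _) _.
    by rewrite normc1; apply: le_trans (expR_ge1Dx _); rewrite lerD2l.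
  have ea : normc (a n) <= expR (C / n%:R).
    have -> : a n = 1 + (a n - 1) by ring.
    apply: e1; rewrite ler_pdivlMr// mulrC -normc_natmul.
    have -> : n%:R * (a n - 1) = z + (n%:R * (a n - 1) - z) by ring.
    by rewrite (le_trans (ler_normcD _ _))// lerD2l.
  have eb : normc (b n) <= expR (C / n%:R).
    rewrite normc_cexp Re_mulrC ler_expR; apply: ler_wpM2r; first by rewrite
      invr_ge0 ltW.
    apply: le_trans (ler_norm _) _; apply: le_trans (le_Re_normc _) _.
    by rewrite lerDl.
  apply: le_trans (normc_subX _ ea eb _) _.
    by rewrite -[leLHS]expR0 ler_expR; apply: divr_ge0 => //; exact: ltW.
  rewrite -expRM_natl [n%:R * (C / _)]mulrC divfK ?gt_eqF// ler_wpM2l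
    ?expR_ge0//.
  rewrite -normc_natmul -(normcN (n%:R * (b n - 1) - z)).
  rewrite (le_trans _ (ler_normcD _ _))// le_eqVlt; apply/orP; left; apply/eqP.
  by congr normc; ring.
rewrite -(mulr0 (expR C)); apply: cvgM; first exact: cvg_cst.
rewrite -[X in _ --> X](addr0 0); apply: cvgD => //; exact: cvg_nmul_cexp.
Unshelve. all: by end_near. Qed.

Definition exp_partial z n : R[i] := \sum_(i < n) z ^+ i * (i`!%:R^-1)%:C.

(** [cexp] is given by cosine and sine, hence the detour through (1 + z / n)^n, which tends to it by
    [cvg_cexpX]. The differences of coefficients 1 / i! - 'C(n, i) / n^i are nonnegative, so the
    distance from the partial sum to (1 + z / n)^n is at most its value at |z|, where both
    expressions tend to the real exponential. *)
Lemma cvg_exp_partial z : normc (exp_partial z n - cexp z) @[n --> \oo] --> 0.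
Proof.
have X (w : R[i]) : normc ((1 + w * (n%:R^-1)%:C) ^+ n - cexp w) @[n --> \oo]
  --> 0.
  apply: cvg_cexpX; apply: (@squeeze_cvg0 _ _ (cst 0)); last exact: cvg_cst.
  near=> n.
  have n0 : (0 : R) < n%:R by rewrite ltr0n; near: n; exists 1%N.
  rewrite addrAC subrr add0r mulrCA -(rmorph_nat (real_complex R)) -rmorphM
    mulfV ?gt_eqF//.
  by rewrite mulr1 subrr normc0 normr0.
pose x : R := normc z.
have coef_ge0 n i : (0 < n)%N -> (i <= n)%N -> 0 <= i`!%:R^-1 - 'C(n, i)%:R /
  n%:R ^+ i :> R.
  move=> n0 ni.
  have n0' : (0 : R) < n%:R ^+ i by rewrite exprn_gt0// ltr0n.
  have i0 : (0 : R) < i`!%:R by rewrite ltr0n fact_gt0.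
  rewrite subr_ge0 ler_pdivrMr// mulrC ler_pdivlMr// -natrX -natrM ler_nat.
  rewrite bin_ffact; elim: {ni n0' i0} i => [|i IH]; first by rewrite ffactn0.
  by rewrite ffactnSr expnSr leq_mul// leq_subr.
rewrite -(cvg_shiftS (fun n => normc (exp_partial z n - cexp z))).
have Xx : `| \sum_(i < n.+1) x ^+ i / i`!%:R - (1 + x / n%:R) ^+ n |
  @[n --> \oo] --> 0.
  rewrite -[X in _ --> X](normr0 R); apply: cvg_norm.
  rewrite -[X in _ --> X](subrr (expR x)); apply: cvgB.
    have /cvg_ex[l hl] := is_cvg_series_exp_coeff x.
    have := hl; rewrite -cvg_shiftS => hl'.
    have -> : expR x = l by rewrite /expR; apply/cvg_lim.
    apply: cvg_trans hl'; apply: near_eq_cvg; near=> n.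
    by rewrite /series/= big_mkord; apply: eq_bigr => i _.
  have hX : Re ((1 + x%:C * (n%:R^-1)%:C) ^+ n) @[n --> \oo] --> expR x.
    by have := cvg_Re_normc (X x%:C); rewrite cexp_real; exact.
  apply: cvg_trans hX; apply: near_eq_cvg; near=> n.
  by rewrite -rmorphM -(rmorph1 (real_complex R)) -rmorphD -rmorphXn.
apply: (@squeeze_cvg0 _ _ (fun n =>
   `| \sum_(i < n.+1) x ^+ i / i`!%:R - (1 + x / n%:R) ^+ n |
   + normc ((1 + z * (n%:R^-1)%:C) ^+ n - cexp z))); last first.
  by rewrite -[X in _ --> X](addr0 0); apply: cvgD => //; exact: X.
near=> n.
have n0 : (0 < n)%N by near: n; exists 1%N.
rewrite /= ger0_norm ?normc_ge0//.
have -> : exp_partial z n.+1 - cexp z =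
  (exp_partial z n.+1 - (1 + z * (n%:R^-1)%:C) ^+ n)
   + ((1 + z * (n%:R^-1)%:C) ^+ n - cexp z) by rewrite addrA subrK.
rewrite (le_trans (ler_normcD _ _))// lerD2r.
apply: le_trans (ler_norm _).
rewrite /exp_partial !exprDn -!sumrB (le_trans (normc_sum _ _ _))// ler_sum// =>
  i _.
have -> : z ^+ i * (i`!%:R^-1)%:C - (1 ^+ (n - i) * (z * (n%:R^-1)%:C) ^+ i) *+
  'C(n, i) =
  z ^+ i * (i`!%:R^-1 - 'C(n, i)%:R / n%:R ^+ i)%:C.
  rewrite expr1n mul1r exprMn rmorphB mulrBr rmorphM !rmorphV ?unitfE ?pnatr_eq0
    -?lt0n ?fact_gt0 ?expf_neq0 ?pnatr_eq0 -?lt0n//=.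
  rewrite !rmorph_nat rmorphXn rmorph_nat exprVn.
  by rewrite -[X in _ - X]mulr_natr mulrA mulrAC.
rewrite normcM normcX normc_real ger0_norm ?coef_ge0//; last by rewrite -ltnS.
rewrite expr1n mul1r exprMn exprVn -mulr_natr mulrBr le_eqVlt; apply/orP; left.
by apply/eqP; rewrite -/x; ring.
Unshelve. all: by end_near. Qed.

End exponential_limits.

(** Summation by parts turns the distance to l into (1 - r) times the sum of (s_(i+1) - l) r^i, up
    to a term vanishing as n grows. The indices below N contribute at most (1 - r) B; the others at
    most e / 2, since (1 - r) times the sum of r^i is at most 1. *)
Lemma abel_limit (R : realType) (a r : nat -> R) (l : R) (A : nat -> R) :
  (forall m, 0 <= r m < 1) -> r m @[m --> \oo] --> (1 : R) ->
  series a n @[n --> \oo] --> l ->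
  (forall m, series (fun i => a i * r m ^+ i) n @[n --> \oo] --> A m) ->
  A m @[m --> \oo] --> l.
Proof.
move=> r01 r1 al aA.
pose s := series a.
have sum_by_parts m n : series (fun i => a i * r m ^+ i) n - l =
  r m ^+ n * (s n - l) + (1 - r m) * \sum_(i < n) (s i.+1 - l) * r m ^+ i.
  rewrite /series/= big_mkord; elim: n => [|n IH].
    by rewrite !big_ord0 /s /series/= big_geq// expr0 mul1r mulr0 addr0.
  rewrite 2!big_ord_recr/= addrAC IH.
  have -> : s n.+1 = s n + a n by rewrite /s /series/= big_nat_recr.
  by rewrite exprS; ring.
apply/cvgrPdist_le => e e0.
have e2 : 0 < e / 2 by rewrite divr_gt0.
have /cvgrPdist_le /(_ _ e2) [N _ hN] := al.
pose B : R := \sum_(i < N) `|s i.+1 - l|.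
have bound m : `|A m - l| <= (1 - r m) * B + e / 2.
  have [rm0 rm1] := andP (r01 m).
  have hl : series (fun i => a i * r m ^+ i) n - l @[n --> \oo] --> A m - l.
    by apply: cvgB; [exact: aA|exact: cvg_cst].
  have /cvg_norm hl' := hl.
  have hr : `|r m ^+ n * (s n - l)| + ((1 - r m) * B + e / 2) @[n --> \oo] -->
     0 + ((1 - r m) * B + e / 2).
    apply: cvgD; last exact: cvg_cst.
    rewrite -[X in _ --> X](normr0 R); apply: cvg_norm.
    rewrite -[X in _ --> X](mul0r 0); apply: cvgM.
      by apply: cvg_expr; rewrite ger0_norm.
    by apply: cvg_sub0.
  rewrite -[leRHS]add0r; apply: (ler_cvg_to hl' hr).
  near=> n; rewrite sum_by_parts (le_trans (ler_normD _ _))// lerD2l normrM.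
  rewrite ger0_norm ?subr_ge0 ?(ltW rm1)//.
  apply: (@le_trans _ _ ((1 - r m) * (B + (\sum_(i < n) r m ^+ i) * (e/2))));
    last first.
    rewrite mulrDr lerD2l mulrA.
    have -> : (1 - r m) * (\sum_(i < n) r m ^+ i) = 1 - r m ^+ n.
      by rewrite -[RHS]opprB subrX1 -mulNr opprB.
    by rewrite ler_piMl ?(ltW e2)// lerBlDr lerDl exprn_ge0.
  rewrite ler_wpM2l ?subr_ge0 ?(ltW rm1)// (le_trans (ler_norm_sum _ _ _))//.
  have h0 i : `|s i.+1 - l| * r m ^+ i <=
    (if (i < N)%N then `|s i.+1 - l| else 0) + r m ^+ i * (e / 2).
    case: ltnP => iN.
      rewrite -[leLHS]addr0; apply: lerD; last by apply: mulr_ge0;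
        [exact: exprn_ge0|exact: ltW].
      by rewrite ler_piMr// exprn_ile1// (ltW rm1).
    rewrite add0r mulrC ler_wpM2l ?exprn_ge0// distrC.
    by apply: (hN i.+1) => /=; rewrite leqW.
  apply: (@le_trans _ _ (\sum_(i < n)
    ((if (i < N)%N then `|s i.+1 - l| else 0) + r m ^+ i * (e / 2)))).
    by apply: ler_sum => i _; rewrite normrM (ger0_norm (exprn_ge0 _ _)).
  rewrite big_split /= mulr_suml lerD2r.
  have nN : (N <= n)%N by near: n; exists N.
  rewrite -(big_mkord xpredT (fun i => if (i < N)%N then `|s i.+1 - l| else 0)).
  rewrite (big_cat_nat _ nN)//= big_mkord [X in _ + X]big1_seq ?addr0.
    by apply: ler_sum => i _; rewrite ltn_ord.
  by move=> i /=; rewrite mem_index_iota leqNgt => /andP[/negbTE ->].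
have : (1 - r m) * B @[m --> \oo] --> (1 - 1) * B.
  by apply: cvgM; [apply: cvgB => //; exact: cvg_cst|exact: cvg_cst].
rewrite subrr mul0r => /cvgrPdist_le /(_ _ e2); apply: filterS => m.
rewrite sub0r normrN => h; rewrite distrC (le_trans (bound m))//.
by rewrite [leRHS]splitr lerD2r (le_trans (ler_norm _)).
Unshelve. all: by end_near. Qed.

(** * Independent pairs, laws, and processes at an independent random time *)

Section joint_law.
Local Open Scope ereal_scope.
Context d d1 d2 (T : measurableType d) (T1 : measurableType d1)
  (T2 : measurableType d2) (R : realType) (P : probability T R).
Variables (f : T -> T1) (g : T -> T2).
Hypotheses (mf : measurable_fun setT f) (mg : measurable_fun setT g).
Hypothesis fg_indep : forall A B, measurable A -> measurable B ->
  P (f @^-1` A `&` g @^-1` B) = (P (f @^-1` A) * P (g @^-1` B))%E.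

Let f' : {mfun T >-> T1} := mfun_Sub (mem_set mf).
Let g' : {mfun T >-> T2} := mfun_Sub (mem_set mg).
Let fg' : {mfun T >-> (T1 * T2)%type} :=
  mfun_Sub (mem_set (measurable_fun_pair mf mg)).

Let joint_distributionE A : measurable A ->
  (distribution P f' \x distribution P g')%E A = distribution P fg' A.
Proof.
by move=> mA; apply: product_measure_unique => // B C mB mC; exact: fg_indep.
Qed.

(** Independence on rectangles makes the law of the pair the product law, by uniqueness of the
    product measure; Tonelli then applies. The variable of g is the outer one because g will be the
    random time. *)
Lemma ge0_integral_independent (F : (T1 * T2)%type -> \bar R) :
  measurable_fun setT F -> (forall z, 0 <= F z)%E ->
  (\int[P]_w F (f w, g w) = \int[P]_w2 \int[P]_w1 F (f w1, g w2))%E.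
Proof.
move=> mF F0.
transitivity (\int[distribution P fg']_z F z)%E.
  by rewrite ge0_integral_distribution.
transitivity (\int[(distribution P f' \x distribution P g')%E]_z F z)%E.
  by apply: eq_measure_integral => A mA _; exact/esym/joint_distributionE.
rewrite fubini_tonelli2// ge0_integral_distribution//=; last 2 first.
- exact: measurable_fun_fubini_tonelli_G.
- by move=> y; apply: integral_ge0.
apply: eq_integral => w _ /=; rewrite /fubini_G ge0_integral_distribution//.
exact: measurableT_comp (measurable_pair2 _).
Qed.

(** Integrability of the product comes first, from the nonnegative case applied to its absolute
    value; Fubini for signed integrands then applies under the product law. *)
Lemma integral_independentM (phi : T1 -> R) (psi : T2 -> R) :
  measurable_fun setT phi -> measurable_fun setT psi ->
  P.-integrable setT (fun w => (phi (f w))%:E) ->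
  P.-integrable setT (fun w => (psi (g w))%:E) ->
  P.-integrable setT (fun w => (phi (f w) * psi (g w))%:E) /\
  \int[P]_w (phi (f w) * psi (g w))%:E =
  \int[P]_w (phi (f w))%:E * \int[P]_w (psi (g w))%:E.
Proof.
move=> mphi mpsi iphi ipsi.
pose F (z : (T1 * T2)%type) := (phi z.1 * psi z.2)%:E.
have mF : measurable_fun setT F.
  by apply/measurable_EFinP/measurable_funM; exact: measurableT_comp.
have iF : P.-integrable setT (fun w => (phi (f w) * psi (g w))%:E).
  apply/integrableP; split.
    by apply/measurable_EFinP/measurable_funM; exact: measurableT_comp.
  have := @ge0_integral_independent (fun z => `|F z|) (measurableT_comp _ mF) _.
  rewrite /F /= => -> //; under eq_integral do under eq_integral do rewrite
    normrM EFinM.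
  under eq_integral => w _.
    rewrite ge0_integralZr//; last first.
      by apply/measurable_EFinP; do 2! apply: measurableT_comp => //.
    over.
  rewrite ge0_integralZl//=; last 2 first.
  - by apply/measurable_EFinP; do 2! apply: measurableT_comp => //.
  - by apply: integral_ge0.
  apply: lte_mul_pinfty; first exact: integral_ge0.
  - rewrite ge0_fin_numE; last exact: integral_ge0.
    by have /integrableP[] := iphi.
  - by have /integrableP[] := ipsi.
split => //.
have iphi' : (distribution P f').-integrable setT (EFin \o phi).
  by apply: integrable_pushforward => //; exact/measurable_EFinP.
have ipsi' : (distribution P g').-integrable setT (EFin \o psi).
  by apply: integrable_pushforward => //; exact/measurable_EFinP.
transitivity (\int[distribution P fg']_z F z).
  by rewrite integral_distribution.
transitivity (\int[distribution P f' \x distribution P g']_z F z).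
  by apply: eq_measure_integral => A mA _; exact/esym/joint_distributionE.
have iF' : (distribution P f' \x distribution P g').-integrable setT F.
  have iF2 : (distribution P fg').-integrable setT F.
    by apply: integrable_pushforward => //; exact: measurable_fun_pair.
  apply/integrableP; split => //; have /integrableP[_] := iF2.
  by rewrite (eq_measure_integral (distribution P f' \x distribution P g')) //
    => A mA _; exact/esym/joint_distributionE.
rewrite -integral21_prod_meas1// /fubini_G /F /=.
transitivity (\int[distribution P g']_y
  ((\int[distribution P f']_x (phi x)%:E) * (psi y)%:E)).
  by apply: eq_integral => y _; under eq_integral do rewrite EFinM;
    rewrite integralZr.
have fphi : \int[distribution P f']_x (phi x)%:E \is a fin_num.
  exact: integrable_fin_num iphi'.
under eq_integral do rewrite -(fineK fphi).
rewrite integralZl// fineK//.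
by rewrite !integral_distribution//; exact/measurable_EFinP.
Qed.

End joint_law.

Section law_determined_by_tails.
Context d d' (T : measurableType d) (T' : measurableType d') (R : realType).
Variables (P : probability T R) (Q : probability T' R).
Variables (X : T -> R) (Y : T' -> R).
Hypotheses (mX : measurable_fun setT X) (mY : measurable_fun setT Y).
Hypothesis tails : forall x, P [set w | x < X w] = Q [set w | x < Y w].

(** Open upper half-lines form a pi-system generating the Borel sets, so equal tails force equal
    laws. *)
Lemma ge0_integral_eq_tails (F : R -> \bar R) :
  measurable_fun setT F -> (forall x, 0 <= F x)%E ->
  (\int[P]_w F (X w) = \int[Q]_w F (Y w))%E.
Proof.
move=> mF F0.
pose X' : {mfun T >-> R} := mfun_Sub (mem_set mX).
pose Y' : {mfun T' >-> R} := mfun_Sub (mem_set mY).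
transitivity (\int[distribution P X']_x F x)%E.
  by rewrite ge0_integral_distribution.
transitivity (\int[distribution Q Y']_x F x)%E; last first.
  by rewrite ge0_integral_distribution.
apply: eq_measure_integral => A mA _.
pose G : set (set R) := [set B | exists x, B = `]x, +oo[%classic].
apply: (@measure_unique _ R _ G (fun n => `](- n%:R), +oo[%classic)) => //.
- exact: RGenOInfty.measurableE.
- move=> _ _ [x ->] [y ->]; exists (Num.max x y).
  by apply/seteqP; split => z /=; rewrite !in_itv/= !andbT gt_max;
    [case=> -> ->|case/andP].
- by move=> i; eexists.
- apply/seteqP; split => // x _; exists (Num.truncn `|x|).+1 => //=.
  rewrite in_itv/= andbT ltrNl (le_lt_trans _ (truncnS_gt _))//.
  by rewrite -normrN ler_norm.
- move=> _ [x ->]; rewrite /= /distribution /pushforward.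
  have -> : X' @^-1` `]x, +oo[ = [set w | x < X w].
    by apply/seteqP; split => w /=; rewrite in_itv/= andbT.
  have -> : Y' @^-1` `]x, +oo[ = [set w | x < Y w].
    by apply/seteqP; split => w /=; rewrite in_itv/= andbT.
  exact: tails.
- by move=> n; rewrite (le_lt_trans (probability_le1 _ _))// ltry.
Qed.

End law_determined_by_tails.

Section right_continuous_process.
Context d1 (T1 : measurableType d1) (R : realType) (H : R -> T1 -> R).
Hypothesis mH : forall s, 0 <= s -> measurable_fun setT (H s).
Hypothesis rcH : forall w s, 0 <= s -> H s' w @[s' --> s^'+] --> H s w.

(** The time y is approached by (floor((n + 1) y) + 1) / (n + 1), which is strictly larger than y,
    so that right continuity applies, and takes countably many values, so that each approximation is
    measurable. The maximum with 0 discards negative times, at which nothing is assumed. *)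
Lemma measurable_right_continuous :
  measurable_fun setT (fun z : (T1 * R)%type => H (Num.max z.2 0) z.1).
Proof.
pose k n (z : (T1 * R)%type) : nat := Num.truncn (n.+1%:R * Num.max z.2 0).
pose s n (z : (T1 * R)%type) : R := (k n z).+1%:R / n.+1%:R.
have n0 n : (0 : R) < n.+1%:R by rewrite ltr0n.
have m0 (z : (T1 * R)%type) : 0 <= Num.max z.2 0 by rewrite le_max lexx orbT.
have s_gt n z : Num.max z.2 0 < s n z.
  by rewrite /s ltr_pdivlMr// mulrC truncnS_gt.
have s_le n z : s n z <= Num.max z.2 0 + n.+1%:R^-1.
  rewrite /s /k -natr1 mulrDl mul1r lerD2r ler_pdivrMr// mulrC.
  by rewrite truncn_le// mulr_ge0.
apply: (@measurable_fun_cvg _ _ _ _ (fun n z => H (s n z) z.1)).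
- move=> n _ B mB; rewrite setTI.
  have mk j : measurable [set z | k n z = j].
    have mf : measurable_fun setT
      (fun z : (T1 * R)%type => n.+1%:R * Num.max z.2 0).
      by apply: measurable_funM => //; apply: measurable_maxr.
    have -> : [set z | k n z = j] = setT `&`
        (fun z : (T1 * R)%type => n.+1%:R * Num.max z.2 0) @^-1`
          `[j%:R, j.+1%:R[.
      rewrite setTI; apply/seteqP; split => z /=; rewrite in_itv/= -truncn_eq
        ?mulr_ge0//.
        by move=> <-.
      by move=> /eqP.
    exact: mf.
  have -> : (fun z => H (s n z) z.1) @^-1` B =
    \bigcup_j ([set z | k n z = j] `&` (fun z => H (j.+1%:R / n.+1%:R) z.1)
      @^-1` B).
    apply/seteqP; split => z /=; first by move=> hB; exists (k n z).
    by move=> [j _ [/= <-]].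
  apply: bigcup_measurable => j _; apply: measurableI => //.
  rewrite -[X in measurable X]setTI.
  have h0 : (0 : R) <= j.+1%:R / n.+1%:R by [].
  exact: (measurableT_comp (mH h0) measurable_fst).
- move=> z _.
  move/cvg_at_rightP : (@rcH z.1 _ (m0 z)) => /(_ (fun n => s n z)); apply;
    split => // .
  apply: (@squeeze_cvgr _ _ _ _ (cst (Num.max z.2 0))
    (fun n => Num.max z.2 0 + n.+1%:R^-1)).
  + by apply: nearW => n; rewrite /= ltW//= s_le.
  + exact: cvg_cst.
  + by rewrite -[X in _ --> X]addr0; apply: cvgD;
      [exact: cvg_cst|exact: cvg_harmonic].
Qed.

End right_continuous_process.

Section mixing.
Context d (T : measurableType d) (R : realType) (P : probability T R).
Variables (G : set (set T)) (H : R -> T -> R) (tau : T -> R).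
Hypothesis mG : forall A, <<s G >> A -> measurable A.
Hypothesis mH : forall s, 0 <= s ->
  @measurable_fun _ _ (g_sigma_algebraType G) R setT (H s).
Hypothesis rcH : forall w s, 0 <= s -> H s' w @[s' --> s^'+] --> H s w.
Hypothesis H_ge0 : forall w s, 0 <= s -> 0 <= H s w.
Hypothesis mtau : measurable_fun setT tau.
Hypothesis tau_ge0 : forall w, 0 <= tau w.
Hypothesis indep : forall A B, <<s G >> A -> measurable B ->
  P (A `&` tau @^-1` B) = (P A * P (tau @^-1` B))%E.

Lemma measurable_mixed : measurable_fun setT (fun w => H (tau w) w).
Proof.
have mid : @measurable_fun _ _ T (g_sigma_algebraType G) setT id.
  by move=> _ B mB; rewrite setTI; exact: mG.
have := measurableT_comp (measurable_right_continuous mH rcH)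
  (measurable_fun_pair mid mtau).
by apply: eq_measurable_fun => w _ /=; rewrite max_l.
Qed.

(** The pair is formed by tau and the identity, seen as a map into the same space equipped with the
    sigma-algebra generated by G. The process is jointly measurable for that sigma-algebra, and
    [indep] is the independence of this pair. *)
Lemma ge0_integral_mixed :
  (\int[P]_w (H (tau w) w)%:E = \int[P]_w2 \int[P]_w1 (H (tau w2) w1)%:E)%E.
Proof.
have mid : @measurable_fun _ _ T (g_sigma_algebraType G) setT id.
  by move=> _ B mB; rewrite setTI; exact: mG.
have mF : measurable_fun setT (fun z : (g_sigma_algebraType G * R)%type =>
    (H (Num.max z.2 0) z.1)%:E).
  by apply/measurable_EFinP; exact: measurable_right_continuous.
have F0 (z : (g_sigma_algebraType G * R)%type) :
  (0 <= (H (Num.max z.2 0) z.1)%:E)%E.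
  by rewrite lee_fin H_ge0// le_max lexx orbT.
have := ge0_integral_independent mid mtau indep mF F0.
rewrite /=; under eq_integral do rewrite max_l//.
move=> ->; apply: eq_integral => w2 _; apply: eq_integral => w1 _.
by rewrite max_l.
Qed.

End mixing.

(** * Truncated integrals and removal of a weight *)

Section truncation.
Context d (T : measurableType d) (R : realType) (P : probability T R).

Lemma ge0_integral_le_truncated (f : T -> R) (C : \bar R) :
  measurable_fun setT f -> (forall w, 0 <= f w) ->
  (forall N : nat, \int[P]_w (Num.min (f w) N%:R)%:E <= C)%E ->
  (\int[P]_w (f w)%:E <= C)%E.
Proof.
move=> mf f0 fC.
pose g n w := (Num.min (f w) n%:R)%:E.
have mg n : measurable_fun setT (g n).
  by apply/measurable_EFinP; apply: measurable_minr.
have g0 n w : setT w -> (0 <= g n w)%E by rewrite lee_fin le_min f0 ler0n.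
have ndg w : setT w -> {homo g^~ w : n m / (n <= m)%N >-> (n <= m)%E}.
  by move=> _ n m nm; rewrite lee_fin le_min !ge_min lexx/= ler_nat nm orbT.
have := cvg_monotone_convergence (mu := P) measurableT mg g0 ndg.
have -> : (fun w => limn (g ^~ w)) = (fun w => (f w)%:E).
  apply/funext => w; apply/cvg_lim => //.
  have [N _ hN] : \forall n \near \oo, f w <= n%:R.
    exists (Num.truncn (f w)).+1 => // n /= hn.
    by rewrite (le_trans (ltW (truncnS_gt _)))// ler_nat.
  apply: cvg_near_cst; exists N => // n Nn /=.
  by rewrite /g min_l//; exact: hN.
by move=> h; apply: (cvge_le _ h); exact: nearW.
Qed.

Lemma integrable_bounded_by (f g : T -> R) : measurable_fun setT f ->
  P.-integrable setT (EFin \o g) -> (forall w, `|f w| <= g w) ->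
  P.-integrable setT (EFin \o f).
Proof.
move=> mf ig fg; apply: (le_integrable measurableT _ _ ig).
  exact/measurable_EFinP.
by move=> w _ /=; rewrite lee_fin (le_trans (fg w))// ler_norm.
Qed.

(* AM-GM: [`|f| * (1 - xi) <= delta / 2 * g ^+ 2 + (1 - xi) / (2 * delta)] *)
Lemma cvg_Rintegral_weight (f g : T -> R) (xi : nat -> T -> R) :
  measurable_fun setT f -> (forall w, `|f w| <= g w) ->
  P.-integrable setT (EFin \o g) ->
  P.-integrable setT (fun w => (g w ^+ 2)%:E) ->
  (forall n, measurable_fun setT (xi n)) ->
  (forall n w, 0 <= xi n w <= 1) ->
  \int[P]_w (1 - xi n w) @[n --> \oo] --> 0 ->
  \int[P]_w (f w * xi n w) @[n --> \oo] --> \int[P]_w f w.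
Proof.
move=> mf fg ig ig2 mxi xi01 xi0.
have if_ := integrable_bounded_by mf ig fg.
have g0 w : 0 <= g w := le_trans (normr_ge0 _) (fg w).
have ifx n : P.-integrable setT (EFin \o (fun w => f w * xi n w)).
  apply: (integrable_bounded_by _ ig); first exact: measurable_funM.
  move=> w; have /andP[x0 x1] := xi01 n w.
  by rewrite normrM (ger0_norm x0) (le_trans _ (fg w))// ler_piMr.
have i1 : P.-integrable setT (EFin \o (fun _ : T => 1 : R)).
  exact: finite_measure_integrable_cst.
have ix n : P.-integrable setT (EFin \o (fun w => 1 - xi n w)).
  apply: (integrable_bounded_by _ i1); first exact: measurable_funB.
  move=> w; have /andP[x0 x1] := xi01 n w.
  by rewrite ger0_norm ?subr_ge0// lerBlDr lerDl.
pose C := \int[P]_w (g w ^+ 2).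
have C0 : 0 <= C by apply: Rintegral_ge0 => w _; exact: sqr_ge0.
have bound n (de : R) : 0 < de ->
   `|\int[P]_w f w - \int[P]_w (f w * xi n w)| <=
   de / 2 * C + (de^-1 / 2) * \int[P]_w (1 - xi n w).
  move=> de0.
  rewrite -RintegralB//.
  have id : P.-integrable setT (EFin \o (fun w => f w - f w * xi n w)).
    by have := integrableB measurableT if_ (ifx n).
  apply: le_trans (le_normr_Rintegral _ id) _ => //.
  rewrite -RintegralZl// -RintegralZl// -RintegralD//; last 2 first.
  - by have := integrableZl measurableT (de / 2) ig2.
  - by have := integrableZl measurableT (de^-1 / 2) (ix n).
  apply: le_Rintegral => //.
  - by have := integrable_norm id.
  - have := integrableD measurableT (integrableZl measurableT (de / 2) ig2)
      (integrableZl measurableT (de^-1 / 2) (ix n)).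
    by [].
  move=> w _ /=; have /andP[x0 x1] := xi01 n w.
  have -> : f w - f w * xi n w = f w * (1 - xi n w) by ring.
  have y0 : 0 <= 1 - xi n w by rewrite subr_ge0.
  rewrite normrM (ger0_norm y0).
  apply: (@le_trans _ _ (g w * (1 - xi n w))); first exact: ler_wpM2r.
  set y := 1 - xi n w; have y1 : y <= 1 by rewrite lerBlDr lerDl.
  have yy : y ^+ 2 <= y by rewrite expr2 ler_piMr.
  have := sqr_ge0 (de * g w - y) => hs.
  have : 2 * de * (g w * y) <= de ^+ 2 * g w ^+ 2 + y.
    have -> : 2 * de * (g w * y) = de ^+ 2 * g w ^+ 2 + y ^+ 2 - (de * g w - y)
      ^+ 2 by ring.
    by lra.
  move=> hh.
  have -> : de / 2 * g w ^+ 2 + de^-1 / 2 * y = (de ^+ 2 * g w ^+ 2 + y) /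
    (2 * de).
    by field; rewrite gt_eqF.
  by rewrite ler_pdivlMr ?mulr_gt0// mulrC.
apply/cvgrPdist_le => e e0.
pose de := e / (C + 1).
have de0 : 0 < de by rewrite divr_gt0// ltr_wpDl.
have e1 : 0 < de * e by rewrite mulr_gt0.
move/cvgrPdist_le: xi0 => /(_ _ e1); apply: filterS => n.
rewrite sub0r normrN => h.
apply: le_trans (bound n _ de0) _.
have -> : e = e / 2 + de^-1 / 2 * (de * e) by field; rewrite gt_eqF.
apply: lerD.
  have h1 : de * (C + 1) = e by rewrite divfK// gt_eqF// ltr_wpDl.
  by rewrite mulrDr mulr1 in h1; lra.
apply: ler_wpM2l; first by rewrite mulr_ge0// invr_ge0 ltW.
exact: le_trans (ler_norm _) h.
Qed.

End truncation.

(** * Counting processes: truncated increments *)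

Section counting_process.
Context d (T : measurableType d) (R : realType) (P : probability T R).
Variables (k : nat) (lam : 'I_k -> R) (M : R -> T -> nat).
Hypothesis hM : gcp P lam M.
Local Open Scope complex_scope.
Local Open Scope ring_scope.
Local Notation Re := complex.Re.
Local Notation Im := complex.Im.

Let levyM : levy_process P (fun t w => (M t w)%:R : R). Proof. by case: hM. Qed.

Lemma measurable_counting t : 0 <= t -> measurable_fun setT (M t).
Proof.
move=> t0 _ Y _; rewrite setTI.
have -> : M t @^-1` Y =
    \bigcup_(m in Y) ((fun w => (M t w)%:R : R) @^-1` [set m%:R]).
  apply/seteqP; split => w /=; first by move=> Yw; exists (M t w).
  by move=> [m Ym] /= /eqP; rewrite eqr_nat => /eqP ->.
apply: bigcup_measurable => m _; rewrite -[X in measurable X]setTI.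
by have [+ _ _ _ _] := levyM; apply.
Qed.

(** The equations are between reals, which avoids the truncated subtraction of naturals and matches
    the form of the Levy hypotheses. *)
Definition increments n (h : R) (g : 'I_n -> nat) : set T :=
  [set w | forall i : 'I_n,
     (M (i.+1%:R * h) w)%:R - (M (i%:R * h) w)%:R = (g i)%:R :> R].

Lemma probability_increments n (h : R) (g : 'I_n -> nat) : 0 < h ->
  P (increments h g) = (\prod_(i < n) P [set w | M h w = g i])%E.
Proof.
move=> h0; have [_ _ incr stat _] := levyM.
have := incr n (fun i => i%:R * h) (fun i => [set (g i)%:R]).
rewrite mul0r lexx => /(_ isT) -> //; last by move=> i; rewrite ltr_pM2r//
  ltr_nat.
apply: eq_bigr => i _.
have := stat (i%:R * h) h [set (g i)%:R]; rewrite mulr_ge0 ?(ltW h0)//.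
have -> : i%:R * h + h = i.+1%:R * h by rewrite -natr1 mulrDl mul1r.
move=> /(_ isT isT (measurable_set1 _)) /= ->.
congr (P _); apply/seteqP; split => w /=; last by move=> ->.
by move=> /eqP; rewrite eqr_nat => /eqP.
Qed.

Lemma measurable_increments n (h : R) (g : 'I_n -> nat) : 0 < h ->
  measurable (increments h g).
Proof.
move=> h0; have [mM _ _ _ _] := levyM.
have -> : increments h g = \bigcap_(i in [set: 'I_n])
   ((fun w => (M (i.+1%:R * h) w)%:R - (M (i%:R * h) w)%:R : R) @^-1`
     [set (g i)%:R]).
  apply/seteqP; split => w /=; first by move=> hw i _; exact: hw.
  by move=> hw i; exact: (hw i I).
apply: fin_bigcap_measurable => // i _.
rewrite -[X in measurable X]setTI.
have mX : measurable_fun setT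
  (fun w => (M (i.+1%:R * h) w)%:R - (M (i%:R * h) w)%:R : R).
  by apply: measurable_funB; apply: mM; rewrite mulr_ge0 ?(ltW h0).
exact: mX.
Qed.

Lemma increments_sum n (h : R) (g : 'I_n -> nat) w : increments h g w ->
  (M 0 w = 0)%N -> M (n%:R * h) w = (\sum_(i < n) g i)%N.
Proof.
move=> hw M0.
apply/eqP; rewrite -(eqr_nat R) natr_sum -(eq_bigr _ (fun i _ => hw i)).
rewrite -(big_mkord xpredT
  (fun i => (M (i.+1%:R * h) w)%:R - (M (i%:R * h) w)%:R)).
by rewrite telescope_sumr// mul0r M0 subr0.
Qed.

(** The indicator that each of the n increments of length h is at most k, spread over the finitely
    many patterns of increments; two patterns exclude each other by [increments_inj]. *)
Definition small_increments n h (w : T) : R :=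
  \sum_(g : {ffun 'I_n -> 'I_k.+1}) \1_(increments h (fun i => g i)) w.

Lemma increments_inj n h (g g' : {ffun 'I_n -> 'I_k.+1}) w :
  increments h (fun i => g i) w -> increments h (fun i => g' i) w -> g = g'.
Proof.
move=> hg hg'; apply/ffunP => i; apply/val_inj => /=.
by apply/eqP; rewrite -(eqr_nat R) -hg hg'.
Qed.

Lemma small_increments01 n h w : 0 <= small_increments n h w <= 1.
Proof.
rewrite /small_increments; apply/andP; split; first exact: sumr_ge0.
have [[g0 hg0]|nog] := pselect (exists g : {ffun 'I_n -> 'I_k.+1},
  increments h (fun i => g i) w).
  rewrite (bigD1 g0)//= big1 ?addr0 ?indicE ?lern1 ?leq_b1// => g ng.
  rewrite indicE memNset// => hg; move/eqP: ng; apply.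
  exact: increments_inj hg hg0.
rewrite big1// => g _; rewrite indicE memNset// => hg.
by apply: nog; exists g.
Qed.

Lemma measurable_small_increments n (h : R) : 0 < h ->
  measurable_fun setT (small_increments n h).
Proof.
move=> h0; apply: measurable_sum => g; apply: measurable_indic.
exact: measurable_increments.
Qed.

Definition mass (j : nat) (h : R) : R := fine (P [set w | M h w = j]).

Lemma massE j (h : R) : 0 <= h -> P [set w | M h w = j] = (mass j h)%:E.
Proof.
move=> h0; rewrite fineK// fin_num_measure//.
rewrite -[X in measurable X]setTI.
exact: (measurable_counting h0 _ (Y := [set j])).
Qed.

(** Since M(0) = 0 almost surely, M(n h) is the sum of g on the event of pattern g, and independence
    with stationarity makes the probability of that event a product of one-step masses. *)
Lemma integral_small_increments n (h : R) (phi : nat -> R) : 0 < h ->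
  (\int[P]_w (phi (M (n%:R * h) w) * small_increments n h w)%:E =
  (\sum_(g : {ffun 'I_n -> 'I_k.+1}) phi (\sum_i g i)%N * \prod_i mass (g i)
    h)%:E)%E.
Proof.
move=> h0.
have mI (g : {ffun 'I_n -> 'I_k.+1}) := measurable_increments (fun i => g i) h0.
transitivity (\int[P]_w (\sum_(g : {ffun 'I_n -> 'I_k.+1})
   (phi (\sum_i g i)%N * \1_(increments h (fun i => g i)) w)%:E))%E.
  apply: ae_eq_integral => //.
  - apply/measurable_EFinP/measurable_funM; last exact:
      measurable_small_increments.
    apply: (@measurableT_comp _ _ _ _ _ _ phi) => //.
    by apply: measurable_counting; rewrite mulr_ge0 ?(ltW h0).
  - apply: emeasurable_sum => g; apply/measurable_EFinP/measurable_funM.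
      exact: measurable_cst.
    by apply: measurable_indic; exact: mI.
  have [_ M0 _ _ _] := levyM; apply: filterS M0 => w /eqP.
  rewrite pnatr_eq0 => /eqP M0 _.
  rewrite sumEFin /small_increments mulr_sumr; congr EFin.
  apply: eq_bigr => g _; rewrite !indicE.
  have [hg|hg] := pselect (increments h (fun i => g i) w).
    by rewrite (increments_sum hg M0).
  by rewrite memNset// !mulr0.
rewrite integral_sum//; last first.
  move=> g; under [X in _.-integrable _ X]eq_fun do rewrite EFinM.
  by apply: integrableZl => //; exact: integrable_indic.
rewrite -sumEFin; apply: eq_bigr => g _.
under eq_integral do rewrite EFinM.
rewrite integralZl//; last exact: integrable_indic.
rewrite integral_indic// setIT EFinM; congr (_ * _)%E.
apply: etrans (probability_increments _ h0) _.
by rewrite -prodEFin; apply: eq_bigr => i _; rewrite massE ?ltW.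
Qed.

(** Generating function of one increment with the mass above k discarded: a polynomial, hence
    available at every complex v. *)
Definition truncated_gf (v : R[i]) (h : R) : R[i] :=
  \sum_(j < k.+1) v ^+ j * (mass j h)%:C.

Lemma truncated_gfX v n h : truncated_gf v h ^+ n =
  \sum_(g : {ffun 'I_n -> 'I_k.+1}) v ^+ (\sum_i g i)%N *
    (\prod_i mass (g i) h)%:C.
Proof.
rewrite -[n in LHS]card_ord -prodr_const /truncated_gf bigA_distr_bigA /=.
apply: eq_bigr => g _; rewrite big_split/= rmorph_prod; congr (_ * _).
by rewrite expr_sum.
Qed.

End counting_process.

(** * Counting processes: the generating function *)

Section counting_process_gf.
Context d (T : measurableType d) (R : realType) (P : probability T R).
Variables (k : nat) (lam : 'I_k -> R) (M : R -> T -> nat).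
Hypothesis hM : gcp P lam M.
Local Open Scope complex_scope.
Local Open Scope ring_scope.
Local Notation Re := complex.Re.
Local Notation Im := complex.Im.
Local Notation tgf := (truncated_gf P k M).
Local Notation mass := (mass P M).

Definition jump_exponent (v : R[i]) : R[i] :=
  \sum_(j < k) (lam j)%:C * (v ^+ j.+1 - 1).

Lemma cvg_rate (p : R -> R) (l t : R) : 0 < t ->
  p h / h @[h --> 0^'+] --> l -> n%:R * p (t / n%:R) @[n --> \oo] --> t * l.
Proof.
move=> t0 pl; rewrite -cvg_shiftS /=.
have h : p (t / n.+1%:R) / (t / n.+1%:R) @[n --> \oo] --> l.
  move/cvg_at_rightP : pl => /(_ (fun n => t / n.+1%:R)); apply; split.
    by move=> n; rewrite divr_gt0.
  by rewrite -(mulr0 t); apply: cvgM; [exact: cvg_cst|exact: cvg_harmonic].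
have : t * (p (t / n.+1%:R) / (t / n.+1%:R)) @[n --> \oo] --> t * l.
  by apply: cvgM => //; exact: cvg_cst.
apply: cvg_trans; apply: near_eq_cvg; near=> n.
rewrite invf_div mulrCA mulrC; congr (_ * _).
by rewrite mulrC divfK// gt_eqF.
Unshelve. all: by end_near. Qed.

(** The difference is an exact linear combination of the errors e and f_j in the rates; the rate of
    1 - P(M(h) = 0) supplies the constant part of the exponent, minus the sum of the lam_j. *)
Lemma cvg_truncated_gf v (t : R) : 0 < t ->
  normc (n%:R * (tgf v (t / n%:R) - 1) - t%:C * jump_exponent v) @[n --> \oo]
    --> 0.
Proof.
move=> t0; have [_ hj h0] := hM.
have cj (j : 'I_k) : n%:R * mass j.+1 (t / n%:R) @[n --> \oo] --> t * lam j.
  exact: (cvg_rate t0 (hj j)).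
have c0 : n%:R * (1 - mass 0 (t / n%:R)) @[n --> \oo] --> t * \sum_j lam j.
  exact: (cvg_rate t0 h0).
pose e n := n%:R * (1 - mass 0 (t / n%:R)) - t * \sum_j lam j.
pose f (j : 'I_k) n := n%:R * mass j.+1 (t / n%:R) - t * lam j.
apply: (@squeeze_cvg0 _ _ (fun n => `|e n| + \sum_(j < k) normc v ^+ j.+1 * `|f
  j n|)).
  apply: nearW => n; rewrite ger0_norm ?normc_ge0//.
  have -> : n%:R * (tgf v (t / n%:R) - 1) - t%:C * jump_exponent v =
     - (e n)%:C + \sum_(j < k) v ^+ j.+1 * (f j n)%:C.
    have -> : jump_exponent v =
        \sum_(j < k) (lam j)%:C * v ^+ j.+1 - (\sum_(j < k) lam j)%:C.
      rewrite rmorph_sum -sumrB; apply: eq_bigr => j _; ring.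
    have -> : \sum_(j < k) v ^+ j.+1 * (f j n)%:C =
        n%:R * (\sum_(j < k) v ^+ j.+1 * (mass j.+1 (t / n%:R))%:C)
        - t%:C * \sum_(j < k) (lam j)%:C * v ^+ j.+1.
      rewrite !mulr_sumr -sumrB; apply: eq_bigr => j _.
      by rewrite /f rmorphB !rmorphM rmorph_nat; ring.
    rewrite /truncated_gf big_ord_recl expr0 mul1r /e.
    rewrite rmorphB !rmorphM rmorphB rmorph1 rmorph_nat /=.
    by under eq_bigr do rewrite /bump /= add1n; ring.
  rewrite (le_trans (ler_normcD _ _))// normcN normc_real lerD2l.
  rewrite (le_trans (normc_sum _ _ _))//; apply: ler_sum => j _.
  by rewrite normcM normcX normc_real.
rewrite -[X in _ --> X](addr0 0); apply: cvgD.
  by rewrite -(normr0 R); apply: cvg_norm; exact: cvg_sub0.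
rewrite [X in _ --> X](_ : 0 = \sum_(j < k) normc v ^+ j.+1 * 0); last first.
  by rewrite big1// => j _; rewrite mulr0.
apply: cvg_big => [|j _]; first exact: add_continuous.
apply: cvgM; first exact: cvg_cst.
by rewrite -(normr0 R); apply: cvg_norm; exact: cvg_sub0.
Qed.

Lemma cvg_truncated_gfX v (t : R) : 0 < t ->
  normc (tgf v (t / n.+1%:R) ^+ n.+1 - cexp (t%:C * jump_exponent v))
    @[n --> \oo] --> 0.
Proof.
move=> t0; have h := cvg_cexpX (cvg_truncated_gf v t0).
by have := h; rewrite -(cvg_shiftS (fun n => normc _)).
Qed.

Let xi t n := small_increments k M n.+1 (t / n.+1%:R).

Let tn (t : R) n : n.+1%:R * (t / n.+1%:R) = t.
Proof. by rewrite mulrC divfK. Qed.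

Lemma integral_weight (t : R) (v : R[i]) (f : R[i] -> R) n : 0 < t ->
  {morph f : x y / x + y} -> (forall z (r : R), f (z * r%:C) = f z * r) ->
  (\int[P]_w (f (v ^+ M t w) * xi t n w)%:E =
    (f (tgf v (t / n.+1%:R) ^+ n.+1))%:E)%E.
Proof.
move=> t0 fD fM; have h0 : 0 < t / n.+1%:R by rewrite divr_gt0.
have := integral_small_increments hM n.+1 (fun m => f (v ^+ m)) h0.
rewrite tn => ->; rewrite truncated_gfX (big_morph f fD (id1 := 0)).
  by congr EFin; apply: eq_bigr => g _; rewrite fM.
by apply: (addrI (f 0)); rewrite -fD !addr0.
Qed.

Let mxi (t : R) n : 0 < t -> measurable_fun setT (xi t n).
Proof. by move=> t0; apply: (measurable_small_increments hM); rewrite divr_gt0.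
  Qed.

Let xi01 t n w : 0 <= xi t n w <= 1.
Proof. exact: small_increments01. Qed.

Let mcomp (phi : nat -> R) t : 0 <= t -> measurable_fun setT
  (fun w => phi (M t w)).
Proof. by move=> t0; apply: (@measurableT_comp _ _ _ _ _ _ phi) => //; exact:
  (measurable_counting hM). Qed.

Let integral_xi (t : R) n : 0 < t ->
  (\int[P]_w (xi t n w)%:E = (Re (tgf 1 (t / n.+1%:R) ^+ n.+1))%:E)%E.
Proof.
move=> t0; rewrite -(@integral_weight t 1 (@complex.Re _))//; last 2 first.
- exact: ReD.
- exact: Re_mulrC.
by under [in RHS]eq_integral do rewrite expr1n mul1r.
Qed.

Let integrable_xi (t : R) n : 0 < t -> P.-integrable setT (EFin \o xi t n).
Proof.
move=> t0; apply: (@integrable_bounded_by _ _ _ _ _ (cst 1)).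
- exact: mxi.
- exact: finite_measure_integrable_cst.
- by move=> w; have /andP[x0 x1] := xi01 t n w; rewrite ger0_norm.
Qed.

(** At v = 1 the weighted mean is that of the weight alone and the exponent vanishes: the
    probability that some increment exceeds k tends to 0. *)
Let cvg_xi (t : R) : 0 < t -> \int[P]_w (1 - xi t n w) @[n --> \oo] --> 0.
Proof.
move=> t0; have h := cvg_Re_normc (cvg_truncated_gfX 1 t0).
have e1 : jump_exponent 1 = 0.
  by rewrite /jump_exponent big1// => j _; rewrite expr1n subrr mulr0.
have {}h : Re (tgf 1 (t / n.+1%:R) ^+ n.+1) @[n --> \oo] --> (1 : R).
  by have := h; rewrite e1 mulr0 cexp0; exact.
have {}h : 1 - Re (tgf 1 (t / n.+1%:R) ^+ n.+1) @[n --> \oo] --> (1 - 1 : R).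
  by apply: cvgB => //; exact: cvg_cst.
rewrite subrr in h; apply: cvg_trans h; apply: near_eq_cvg; near=> n.
rewrite RintegralB//; last 2 first.
- exact: finite_measure_integrable_cst.
- exact: integrable_xi.
rewrite Rintegral_cst// mul1r; congr (_ - _); last by rewrite /Rintegral
  integral_xi.
exact/esym/(congr1 fine (probability_setT P)).
Unshelve. all: by end_near. Qed.

(** Integrability of r^M is still unknown, so r^M is capped at N and split by the weight: the first
    part is at most r^M xi, of explicit mean, the second at most N (1 - xi). Letting n grow at fixed
    N leaves a bound free of N. *)
Lemma counting_process_mgf (r t : R) : 0 <= t -> 0 <= r ->
  (\int[P]_w (r ^+ M t w)%:E <= (expR (t * Re (jump_exponent r%:C)))%:E)%E.
Proof.
move=> t0 r0; move: t0; rewrite le_eqVlt => /predU1P[<-|t0].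
  rewrite mul0r expR0.
  rewrite (@ae_eq_integral _ _ _ _ _ (cst 1%:E))//; first by rewrite
    integral_cst// mul1e probability_le1.
    by apply/measurable_EFinP; exact: (mcomp (fun m => r ^+ m)).
  have [[_ M0 _ _ _] _ _] := hM; apply: filterS M0 => w /eqP.
  by rewrite pnatr_eq0 => /eqP -> _; rewrite expr0.
have mr := mcomp (fun m => r ^+ m) (ltW t0).
apply: ge0_integral_le_truncated => // [w|N]; first exact: exprn_ge0.
have h1 n : (\int[P]_w (r ^+ M t w * xi t n w)%:E =
  (Re (tgf r%:C (t / n.+1%:R) ^+ n.+1))%:E)%E.
  rewrite -(@integral_weight t r%:C (@complex.Re _))//; last 2 first.
  - exact: ReD.
  - exact: Re_mulrC.
  by under [in RHS]eq_integral do rewrite -rmorphXn.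
have bound n : (\int[P]_w (Num.min (r ^+ M t w) N%:R)%:E <=
   (Re (tgf r%:C (t / n.+1%:R) ^+ n.+1) + N%:R * \int[P]_w
     (1 - xi t n w))%:E)%E.
  have xi1 : P.-integrable setT (EFin \o (fun w => 1 - xi t n w)).
    have i1 : P.-integrable setT (EFin \o (fun _ : T => 1 : R)).
      exact: finite_measure_integrable_cst.
    by have := integrableB measurableT i1 (integrable_xi n t0).
  rewrite EFinD -h1 EFinM fineK; last exact: integrable_fin_num xi1.
  rewrite -ge0_integralZl//; last 2 first.
  - by apply/measurable_EFinP; apply: measurable_funB => //; exact: mxi.
  - by move=> w _; have /andP[_ x1] := xi01 t n w; rewrite lee_fin subr_ge0.
  rewrite -ge0_integralD//; last 4 first.
  - by move=> w _; have /andP[x0 x1] := xi01 t n w; rewrite lee_fin mulr_ge0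
      ?exprn_ge0.
  - by apply/measurable_EFinP; apply: measurable_funM => //; exact: mxi.
  - by move=> w _; have /andP[x0 x1] := xi01 t n w; rewrite -EFinM lee_fin
      mulr_ge0 ?subr_ge0.
  - apply/measurable_EFinP; apply: measurable_funM => //; apply: measurable_funB
      => //; exact: mxi.
  apply: ge0_le_integral => //.
  - by move=> w _; rewrite lee_fin le_min exprn_ge0//=.
  - by apply/measurable_EFinP; apply: measurable_minr.
  - apply: emeasurable_funD; apply/measurable_EFinP; apply: measurable_funM =>
      //; first exact: mxi.
    by apply: measurable_funB => //; exact: mxi.
  move=> w _; have /andP[x0 x1] := xi01 t n w.
  have {1}-> : Num.min (r ^+ M t w) N%:R =
      Num.min (r ^+ M t w) N%:R * xi t n w + Num.min (r ^+ M t w) N%:R *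
        (1 - xi t n w) :> R.
    by ring.
  by apply: lerD; apply: ler_wpM2r; rewrite ?subr_ge0// ge_min lexx ?orbT.
have hlim : Re (tgf r%:C (t / n.+1%:R) ^+ n.+1) + N%:R * \int[P]_w
  (1 - xi t n w)
   @[n --> \oo] --> expR (t * Re (jump_exponent r%:C)) + N%:R * 0.
  apply: cvgD; last by apply: cvgM; [exact: cvg_cst|exact: cvg_xi].
  have := cvg_Re_normc (cvg_truncated_gfX r%:C t0).
  have -> : t%:C * jump_exponent r%:C = (t * Re (jump_exponent r%:C))%:C.
    rewrite rmorphM; congr (_ * _).
    have -> : jump_exponent r%:C = (\sum_j lam j * (r ^+ j.+1 - 1))%:C.
      by rewrite rmorph_sum; apply: eq_bigr => j _; rewrite rmorphM rmorphB
        rmorph1 rmorphXn.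
    by [].
  by rewrite cexp_real; exact.
rewrite mulr0 addr0 in hlim.
have hf : (\int[P]_w (Num.min (r ^+ M t w) N%:R)%:E)%E \is a fin_num.
  rewrite ge0_fin_numE; last by apply: integral_ge0 => w _; rewrite lee_fin
    le_min exprn_ge0//=.
  by rewrite (le_lt_trans (bound 0%N))// ltry.
rewrite -(fineK hf) lee_fin; apply: (ler_cvg_to (cvg_cst _) hlim).
by apply: nearW => n /=; rewrite -lee_fin fineK.
Qed.

Lemma integrable_counting_process (r t : R) : 0 <= t -> 0 <= r ->
  P.-integrable setT (fun w => (r ^+ M t w)%:E).
Proof.
move=> t0 r0; apply/integrableP; split.
  by apply/measurable_EFinP; exact: (mcomp (fun m => r ^+ m)).
under eq_integral do rewrite gee0_abs ?lee_fin ?exprn_ge0//.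
by rewrite (le_lt_trans (counting_process_mgf t0 r0))// ltry.
Qed.

(** [cvg_Rintegral_weight] removes the weight, with dominating function |v|^M; its square is
    (|v|^2)^M, integrable by the bound on moments at |v|^2. *)
Lemma counting_process_gf v t (f : R[i] -> R) : 0 <= t ->
  {morph f : x y / x - y} -> (forall z (r : R), f (z * r%:C) = f z * r) ->
  (forall z, `|f z| <= normc z) ->
  \int[P]_w f (v ^+ M t w) = f (cexp (t%:C * jump_exponent v)).
Proof.
move=> t0 fB fM fle.
have mf := mcomp (fun m => f (v ^+ m)) t0.
have f0 : f 0 = 0 by rewrite -[0 in LHS](subrr 0) fB subrr.
have fD : {morph f : x y / x + y}.
  by move=> x y; rewrite -[y in LHS]opprK fB -[- y]sub0r fB f0 sub0r opprK.
(* At t = 0 there is nothing to subdivide; M(0) = 0 almost surely settles the case. *)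
move: (t0); rewrite le_eqVlt => /predU1P[t0'|tp].
  rewrite -t0' mul0r cexp0 /Rintegral.
  rewrite (@ae_eq_integral _ _ _ _ _ (cst (f 1)%:E))//.
  - rewrite integral_cst// -[RHS]/(fine (f 1)%:E) -[(f 1)%:E in RHS]mule1.
    by congr (fine (_ * _)%E); exact: probability_setT.
  - by apply/measurable_EFinP; move: mf; rewrite -t0'.
  have [[_ M0 _ _ _] _ _] := hM; apply: filterS M0 => w /eqP.
  by rewrite pnatr_eq0 => /eqP -> _; rewrite expr0.
have ig := integrable_counting_process t0 (normc_ge0 v).
have ig2 : P.-integrable setT (fun w => ((normc v ^+ M t w) ^+ 2)%:E).
  have := integrable_counting_process t0 (exprn_ge0 2 (normc_ge0 v)).
  by under eq_fun do rewrite exprAC.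
have fg w : `|f (v ^+ M t w)| <= normc v ^+ M t w by rewrite -normcX fle.
have h := cvg_Rintegral_weight mf fg ig ig2 (fun n => mxi n tp) (xi01 t)
  (cvg_xi tp).
apply: (cvg_unique _ h) => /=; first exact: norm_hausdorff.
have hl : f (tgf v (t / n.+1%:R) ^+ n.+1) @[n --> \oo] -->
  f (cexp (t%:C * jump_exponent v)).
  apply/cvgrPdist_le => e e0.
  have /cvgrPdist_le/(_ _ e0) := cvg_truncated_gfX v tp; apply: filterS => n.
  rewrite sub0r normrN ger0_norm ?normc_ge0// => /(le_trans _); apply.
  by rewrite distrC -fB fle.
apply: cvg_trans hl; apply: near_eq_cvg; near=> n.
by rewrite /Rintegral integral_weight.
Unshelve. all: by end_near. Qed.

End counting_process_gf.

(** * Integer-valued processes at a random time *)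

Section integer_valued_process.
Context d (T : measurableType d) (R : realType) (P : probability T R).

Lemma measurable_image_intr (Y : set int) :
  measurable ((fun z : int => z%:~R : R) @` Y).
Proof.
apply: countable_measurable => [x|]; first exact: measurable_set1.
exact: sub_countable (card_image_le _ _) (countableP _).
Qed.

Lemma intr_image_preimage (U : Type) (X : U -> int) (Y : set int) :
  X @^-1` Y = (fun w => (X w)%:~R : R) @^-1` ((fun z : int => z%:~R) @` Y).
Proof.
apply/seteqP; split => w /=; first by move=> Yw; exists (X w).
by move=> [z Yz] /eqP; rewrite eqr_int => /eqP <-.
Qed.

(** Every set of integers has a countable, hence Borel, image in R, so h may be arbitrary. *)
Lemma measurable_int_fun (Z : T -> int) (h : int -> R) :
  measurable_fun setT (fun w => (Z w)%:~R : R) -> measurable_fun setT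
    (fun w => h (Z w)).
Proof.
move=> mZ _ B mB; rewrite setTI.
rewrite -[X in measurable X]/(Z @^-1` (h @^-1` B)).
rewrite intr_image_preimage -[X in measurable X]setTI.
by apply: mZ => //; exact: measurable_image_intr.
Qed.

(** Right continuity for a discrete-valued process, in a form that passes to h (X s w) for every
    function h. *)
Definition right_constant (V : Type) (X : R -> T -> V) :=
  forall w s, 0 <= s -> \forall s' \near s^'+, X s' w = X s w.

Variables (X : R -> T -> int) (tau : T -> R).
Hypothesis mX : forall s, 0 <= s -> measurable_fun setT
  (fun w => (X s w)%:~R : R).
Hypothesis rX : right_constant X.
Hypothesis mtau : measurable_fun setT tau.
Hypothesis tau_ge0 : forall w, 0 <= tau w.
Hypothesis indep : forall A B, process_sigma (fun s w => (X s w)%:~R : R) A ->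
  measurable B -> P (A `&` tau @^-1` B) = (P A * P (tau @^-1` B))%E.
Variable h : int -> R.

Let G : set (set T) := [set A | exists s (B : set R),
  [/\ 0 <= s, measurable B & A = (fun w => (X s w)%:~R) @^-1` B]].

Let mG A : <<s G >> A -> measurable A.
Proof.
apply: smallest_sub; first exact: sigma_algebra_measurable.
move=> _ [s [B [s0 mB ->]]]; rewrite -[X in measurable X]setTI; exact: mX.
Qed.

Let mh s : 0 <= s ->
  @measurable_fun _ _ (g_sigma_algebraType G) R setT (fun w => h (X s w)).
Proof.
move=> s0 _ B mB; rewrite setTI; apply: sub_sigma_algebra.
exists s, ((fun z : int => z%:~R) @` (h @^-1` B)); split => //.
  exact: measurable_image_intr.
exact: (intr_image_preimage (X s) (h @^-1` B)).
Qed.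

Let rh w s : 0 <= s -> h (X s' w) @[s' --> s^'+] --> h (X s w).
Proof.
move=> s0; apply: cvg_near_cst; have := rX w s0.
by apply: filterS => s1 ->.
Qed.

Lemma measurable_process_at : measurable_fun setT (fun w => h (X (tau w) w)).
Proof. exact: (measurable_mixed mG mh rh mtau). Qed.

Lemma ge0_integral_process_at : (forall z, 0 <= h z) ->
  (\int[P]_w (h (X (tau w) w))%:E =
   \int[P]_w2 \int[P]_w1 (h (X (tau w2) w1))%:E)%E.
Proof.
by move=> h0; apply: (ge0_integral_mixed mG mh rh _ mtau tau_ge0 indep) =>
  w s _; exact: h0.
Qed.

End integer_valued_process.

Lemma cadlag_nat_right_constant d (T : measurableType d) (R : realType)
    (M : R -> T -> nat) : (forall w, cadlag (fun t => (M t w)%:R : R)) ->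
  right_constant (R := R) M.
Proof.
move=> cM w s s0; have [/(_ s s0) rc _] := cM w.
have near1 : \forall s' \near s^'+, `|(M s w)%:R - (M s' w)%:R| < (1 : R).
  by move/cvgrPdist_lt : rc; apply.
apply: filterS near1 => s' near1.
have [lt|lt|//] := ltngtP (M s' w) (M s w); exfalso; move: near1; apply/negP;
  rewrite -leNgt.
- by rewrite -natrB ?(ltnW lt)// normr_nat ler1n subn_gt0.
- by rewrite distrC -natrB ?(ltnW lt)// normr_nat ler1n subn_gt0.
Qed.

(** * The Skellam process at a fixed time *)

Section skellam.
Context d (T : measurableType d) (R : realType) (P : probability T R).
Variables (k : nat) (lam mu : 'I_k -> R) (S : R -> T -> int).
Hypothesis hS : gsp P lam mu S.
Local Open Scope complex_scope.
Local Open Scope ring_scope.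
Local Notation Re := complex.Re.
Local Notation Im := complex.Im.

Lemma measurable_skellam s : 0 <= s ->
  measurable_fun setT (fun w => (S s w)%:~R : R).
Proof.
move=> s0; have [M1 [M2 [[[m1 _ _ _ _] _ _] [[m2 _ _ _ _] _ _] _ SE]]] := hS.
have := measurable_funB (m1 s s0) (m2 s s0); apply: eq_measurable_fun => w _.
by rewrite SE// rmorphB.
Qed.

Lemma right_constant_skellam : right_constant S.
Proof.
have [M1 [M2 [[[_ _ _ _ c1] _ _] [[_ _ _ _ c2] _ _] _ SE]]] := hS.
move=> w s s0.
have h1 := cadlag_nat_right_constant c1 w s0.
have h2 := cadlag_nat_right_constant c2 w s0.
near=> s'.
have ss' : s < s' by near: s'; exact: nbhs_right_gt.
rewrite !SE ?(ltW (le_lt_trans s0 ss'))//.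
have -> : M1 s' w = M1 s w by near: s'.
by have -> : M2 s' w = M2 s w by near: s'.
Unshelve. all: by end_near. Qed.

Lemma skellam_exponentE (u : R[i]) : skellam_exponent lam mu u =
  jump_exponent lam u + jump_exponent mu u^-1.
Proof.
rewrite /skellam_exponent /jump_exponent -big_split /=.
by apply: eq_bigr => j _; rewrite exprVn.
Qed.

Let indepM (M1 M2 : R -> T -> nat) s (A B : set nat) : 0 <= s ->
  independent_processes P (fun t w => (M1 t w)%:R : R) (fun t w => (M2 t w)%:R)
    ->
  P (M1 s @^-1` A `&` M2 s @^-1` B) = (P (M1 s @^-1` A) * P (M2 s @^-1` B))%E.
Proof.
move=> s0; apply.
- apply: sub_sigma_algebra.
  exists s, ((fun z : int => z%:~R : R) @` (Posz @` A)); split => //.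
    exact: measurable_image_intr.
  rewrite -(intr_image_preimage R (fun w => Posz (M1 s w))).
  apply/seteqP; split => w /=; first by exists (M1 s w).
  by move=> [m Am [<-]].
- apply: sub_sigma_algebra.
  exists s, ((fun z : int => z%:~R : R) @` (Posz @` B)); split => //.
    exact: measurable_image_intr.
  rewrite -(intr_image_preimage R (fun w => Posz (M2 s w))).
  apply/seteqP; split => w /=; first by exists (M2 s w).
  by move=> [m Am [<-]].
Qed.

Variable u : R[i].
Hypothesis u0 : u != 0.

(** As u^S = u^M1 (u^-1)^M2, independence factors the expectation, and the jump exponents at u and
    at u^-1 add up to the Skellam exponent. *)
Lemma skellam_gf s : 0 <= s ->
  [/\ P.-integrable setT (fun w => (normc u ^ S s w)%:E),
      \int[P]_w Re (u ^ S s w) = Re (cexp (s%:C * skellam_exponent lam mu u))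
    & \int[P]_w Im (u ^ S s w) = Im (cexp (s%:C * skellam_exponent lam mu u))].
Proof.
move=> s0; have [M1 [M2 [h1 h2 i12 SE]]] := hS.
have nu0 : normc u != 0 by apply: contra_neq u0; exact: eq0_normc.
have uS w : u ^ S s w = u ^+ M1 s w * u^-1 ^+ M2 s w.
  by rewrite SE// expfzDr// exprVn -exprnN.
have nuS w : normc u ^ S s w = normc u ^+ M1 s w * normc u^-1 ^+ M2 s w.
  by rewrite SE// expfzDr// normcV exprVn -exprnN.
have m1 := measurable_counting h1 s0; have m2 := measurable_counting h2 s0.
have ind A B (_ : measurable A) (_ : measurable B) := @indepM M1 M2 s A B s0
  i12.
have mnat (phi : nat -> R) : measurable_fun setT phi by [].
have I1 : P.-integrable setT (fun w => (normc u ^+ M1 s w)%:E).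
  exact: (integrable_counting_process h1 s0 (normc_ge0 _)).
have I2 : P.-integrable setT (fun w => (normc u^-1 ^+ M2 s w)%:E).
  exact: (integrable_counting_process h2 s0 (normc_ge0 _)).
have int1 (f : R[i] -> R) : (forall z, `|f z| <= normc z) ->
    P.-integrable setT (fun w => (f (u ^+ M1 s w))%:E).
  move=> fle; apply: (@integrable_bounded_by _ _ _ _ _
    (fun w => normc u ^+ M1 s w)) => //.
    exact: (measurableT_comp (mnat (fun m => f (u ^+ m))) m1).
  by move=> w; rewrite -normcX.
have int2 (f : R[i] -> R) : (forall z, `|f z| <= normc z) ->
    P.-integrable setT (fun w => (f (u^-1 ^+ M2 s w))%:E).
  move=> fle; apply: (@integrable_bounded_by _ _ _ _ _
    (fun w => normc u^-1 ^+ M2 s w)) => //.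
    exact: (measurableT_comp (mnat (fun m => f (u^-1 ^+ m))) m2).
  by move=> w; rewrite -normcX.
(* Independence gives products of real expectations, so the complex product is assembled from the
   four combinations of [Re] and [Im]; taking [normc] twice gives the integrability of |u|^S. *)
have prod (f g : R[i] -> R) : (forall z, `|f z| <= normc z) ->
  (forall z, `|g z| <= normc z) ->
   P.-integrable setT (EFin \o (fun w => f (u ^+ M1 s w) * g (u^-1 ^+ M2 s w)))
     /\
   \int[P]_w (f (u ^+ M1 s w) * g (u^-1 ^+ M2 s w)) =
   \int[P]_w f (u ^+ M1 s w) * \int[P]_w g (u^-1 ^+ M2 s w).
  move=> hf hg.
  have [J1 J2] := integral_independentM m1 m2 ind (mnat (fun m => f (u ^+ m)))
    (mnat (fun m => g (u^-1 ^+ m))) (int1 _ hf) (int2 _ hg).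
  split => //; rewrite /Rintegral J2 fineM//.
    exact: (integrable_fin_num _ (int1 _ hf)).
  exact: (integrable_fin_num _ (int2 _ hg)).
have g1 := counting_process_gf h1 u s0; have g2 := counting_process_gf h2 u^-1
  s0.
have [rr rrE] := prod _ _ (@le_Re_normc R) (@le_Re_normc R).
have [ri riE] := prod _ _ (@le_Re_normc R) (@le_Im_normc R).
have [ir irE] := prod _ _ (@le_Im_normc R) (@le_Re_normc R).
have [ii iiE] := prod _ _ (@le_Im_normc R) (@le_Im_normc R).
have gR1 := g1 _ (@ReB R) (@Re_mulrC R) (@le_Re_normc R).
have gI1 := g1 _ (@ImB R) (@Im_mulrC R) (@le_Im_normc R).
have gR2 := g2 _ (@ReB R) (@Re_mulrC R) (@le_Re_normc R).
have gI2 := g2 _ (@ImB R) (@Im_mulrC R) (@le_Im_normc R).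
have ReM (z w : R[i]) : Re (z * w) = Re z * Re w - Im z * Im w by case: z w =>
  ? ? [].
have ImM (z w : R[i]) : Im (z * w) = Re z * Im w + Im z * Re w by case: z w =>
  ? ? [].
split.
- under [X in _.-integrable _ X]eq_fun do rewrite nuS.
  have nn (z : R[i]) : `|normc z| <= normc z by rewrite ger0_norm ?normc_ge0.
  have [+ _] := prod _ _ nn nn; congr (_.-integrable _ _).
  by apply/funext => w /=; rewrite !normcX.
- under eq_Rintegral do rewrite uS ReM.
  rewrite RintegralB// rrE iiE gR1 gI1 gR2 gI2 -ReM -cexpD -mulrDr.
  by rewrite skellam_exponentE.
- under eq_Rintegral do rewrite uS ImM.
  rewrite RintegralD// riE irE gR1 gI1 gR2 gI2 -ImM -cexpD -mulrDr.
  by rewrite skellam_exponentE.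
Qed.

End skellam.

(** * A Laplace transform determines the tails of a law *)

Section laplace_transform_uniqueness.
Variable R : realType.

Lemma bernoulli_onem (y : R) n : 0 <= y <= 1 -> 1 - n%:R * y <= (1 - y) ^+ n.
Proof.
move=> /andP[y0 y1]; elim: n => [|n IH]; first by rewrite mul0r subr0 expr0.
rewrite exprS; apply: (@le_trans _ _ ((1 - y) * (1 - n%:R * y))).
  have -> : (1 - y) * (1 - n%:R * y) = 1 - n.+1%:R * y + n%:R * y ^+ 2 by
    rewrite -natr1; ring.
  by rewrite lerDl mulr_ge0// sqr_ge0.
by rewrite ler_wpM2l// subr_ge0.
Qed.

(** Roughly m e^(m x): then 1 - e^(- m a) raised to this power behaves like exp(- m e^(m (x - a))),
    which tends to 1 for a > x and to 0 for a <= x. The factor m is what gives the limit 0 in the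
    boundary case a = x. *)
Definition step_power (x : R) (m : nat) : nat :=
  (m * (Num.truncn (expR (m%:R * x))).+1)%N.

Lemma step_power_ge x m : m%:R * expR (m%:R * x) <= (step_power x m)%:R.
Proof. by rewrite natrM ler_wpM2l// ltW// truncnS_gt. Qed.

Lemma step_power_le x m : 0 <= x -> (step_power x m)%:R <= m%:R *
  (2 * expR (m%:R * x)).
Proof.
move=> x0; rewrite natrM ler_wpM2l// -natr1.
have e1 : 1 <= expR (m%:R * x) by rewrite -[leLHS]expR0 ler_expR mulr_ge0.
have : (Num.truncn (expR (m%:R * x)))%:R <= expR (m%:R * x) by rewrite
  truncn_le// expR_ge0.
by move=> h; lra.
Qed.

(* Integrating these powers gives combinations of values of the Laplace
   transform at integers. *)
Definition laplace_step (x a : R) (m : nat) : R :=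
  (1 - expR (- (m%:R * a))) ^+ step_power x m.

Lemma laplace_step01 x a m : 0 <= a -> 0 <= laplace_step x a m <= 1.
Proof.
move=> a0; have e1 : expR (- (m%:R * a)) <= 1.
  by rewrite -[leRHS]expR0 ler_expR oppr_le0 mulr_ge0.
by rewrite exprn_ge0 ?exprn_ile1 ?subr_ge0 ?lerBlDr ?lerDl ?expR_ge0.
Qed.

Lemma cvg_expRN : expR (- (m%:R : R)) @[m --> \oo] --> 0.
Proof.
have := cvg_comp _ _ (@cvgr_idn R) (@cvgr_expR R).
by [].
Qed.

(** For a <= x, the inequality 1 - y <= exp(- y) bounds the power by exp(- m); for x < a,
    Bernoulli's inequality bounds it from below. *)
Lemma cvg_laplace_step x a : 0 <= x -> 0 <= a ->
  laplace_step x a m @[m --> \oo] --> ((x < a)%R%:R : R).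
Proof.
move=> x0 a0; have [xa|ax] := ltP x a; last first.
  apply: (squeeze_cvg0 _ cvg_expRN); apply: nearW => m.
  have /andP[h0 _] := laplace_step01 x m a0.
  rewrite ger0_norm//.
  have e1 : expR (- (m%:R * a)) <= 1 by rewrite -[leRHS]expR0 ler_expR oppr_le0
    mulr_ge0.
  apply: (@le_trans _ _ (expR (- expR (- (m%:R * a))) ^+ step_power x m)).
    by apply: lerXn2r; rewrite ?nnegrE ?expR_ge0 ?subr_ge0// expR_ge1Dx.
  rewrite -expRM_natl ler_expR mulrN lerN2.
  apply: le_trans (ler_wpM2r (expR_ge0 _) (step_power_ge x m)).
  rewrite -mulrA -expRD -mulrBr ler_peMr// -[leLHS]expR0 ler_expR.
  by rewrite mulr_ge0// subr_ge0.
have d0 : 0 < a - x by rewrite subr_gt0.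
(* The factor 2 is that of [step_power_le]; the rest comes from (z / 2)^2 <= exp(z) at z = (m + 1)
   (a - x), whence (m + 1) exp(- z) <= 4 / ((a - x)^2 (m + 1)). *)
have h1 m : 1 - 2 * (4 / (a - x) ^+ 2) * m.+1%:R^-1 <= laplace_step x a m.+1 <=
  1.
  have /andP[_ ->] := laplace_step01 x m.+1 a0; rewrite andbT.
  have e1 : 0 <= expR (- (m.+1%:R * a)) <= 1.
    by rewrite expR_ge0 -[leRHS]expR0 ler_expR oppr_le0 mulr_ge0.
  apply: le_trans (bernoulli_onem (step_power x m.+1) e1).
  rewrite lerD2l lerN2.
  apply: le_trans (ler_wpM2r (expR_ge0 _) (step_power_le m.+1 x0)) _.
  have -> : m.+1%:R * (2 * expR (m.+1%:R * x)) * expR (- (m.+1%:R * a)) =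
     2 * (m.+1%:R * expR (- (m.+1%:R * (a - x)))).
    have -> : - (m.+1%:R * (a - x)) = m.+1%:R * x - m.+1%:R * a by ring.
    by rewrite expRD; ring.
  rewrite -mulrA ler_wpM2l//.
  set z := m.+1%:R * (a - x).
  have z0 : 0 < z by rewrite mulr_gt0.
  have : (z / 2) ^+ 2 <= expR z.
    have -> : expR z = expR (z / 2) ^+ 2 by rewrite -expRM_natl mulrC divfK.
    apply: lerXn2r; rewrite ?nnegrE ?expR_ge0 ?divr_ge0 ?(ltW z0)//.
    by apply: le_trans (expR_ge1Dx _); rewrite lerDr.
  move=> hz; rewrite expRN ler_pdivrMr ?expR_gt0//.
  apply: le_trans (ler_wpM2l _ hz); last by rewrite mulr_ge0 ?invr_ge0//
    divr_ge0// sqr_ge0.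
  rewrite /z le_eqVlt; apply/orP; left; apply/eqP; field.
  by rewrite (gt_eqF d0) andbT gt_eqF// addrC natr1.
rewrite -cvg_shiftS /=.
apply: (@squeeze_cvgr _ _ _ _ (fun m => 1 - 2 * (4 / (a - x) ^+ 2) * m.+1%:R^-1)
  (cst 1)).
- by apply: nearW => m; exact: h1.
- rewrite -[X in _ --> X]subr0; apply: cvgB; first exact: cvg_cst.
  rewrite -[X in _ --> X](mulr0 (2 * (4 / (a - x) ^+ 2))); apply: cvgM;
    first exact: cvg_cst.
  exact: cvg_harmonic.
- exact: cvg_cst.
Qed.

Section one_variable.
Context d (T : measurableType d) (P : probability T R) (X : T -> R).
Hypotheses (mX : measurable_fun setT X) (X0 : forall w, 0 <= X w).

Definition laplace (s : R) : R := \int[P]_w expR (- (s * X w)).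

Let mexp s : measurable_fun setT (fun w => expR (- (s * X w))).
Proof. by apply: measurableT_comp => //; apply: measurableT_comp => //; exact:
  measurable_funM. Qed.

Let i1 : P.-integrable setT (EFin \o (fun _ : T => 1 : R)).
Proof. exact: finite_measure_integrable_cst. Qed.

Lemma integrable_laplace s : 0 <= s -> P.-integrable setT
  (EFin \o (fun w => expR (- (s * X w)))).
Proof.
move=> s0; apply: (integrable_bounded_by (mexp s) i1) => w.
by rewrite ger0_norm ?expR_ge0// -[leRHS]expR0 ler_expR oppr_le0 mulr_ge0.
Qed.

Lemma integral_laplace_step x m : (\int[P]_w (laplace_step x (X w) m)%:E)%E =
  (\sum_(i < (step_power x m).+1)
     ((-1) ^+ i *+ 'C(step_power x m, i) * laplace (m%:R * i%:R)))%:E.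
Proof.
set N := step_power x m.
have E w : laplace_step x (X w) m =
   \sum_(i < N.+1) ((-1) ^+ i *+ 'C(N, i)) * expR (- (m%:R * i%:R * X w)).
  rewrite /laplace_step exprBn; apply: eq_bigr => i _.
  rewrite expr1n mulr1 -expRM_natl -mulrnAl; congr (_ * expR _); ring.
under eq_integral do rewrite E -sumEFin.
rewrite integral_sum//; last first.
  move=> i; under [X in _.-integrable _ X]eq_fun do rewrite EFinM.
  by apply: integrableZl => //; apply: integrable_laplace; rewrite mulr_ge0.
rewrite -sumEFin; apply: eq_bigr => i _.
under eq_integral do rewrite EFinM.
rewrite integralZl//; last by apply: integrable_laplace; rewrite mulr_ge0.
rewrite EFinM; congr (_ * _)%E; rewrite fineK//.
by apply: integrable_fin_num => //; apply: integrable_laplace; rewrite mulr_ge0.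
Qed.

Lemma cvg_integral_laplace_step x : 0 <= x ->
  (\int[P]_w (laplace_step x (X w) m)%:E)%E @[m --> \oo] -->
    P [set w | x < X w].
Proof.
move=> x0.
have mset : measurable [set w | x < X w].
  have -> : [set w | x < X w] = X @^-1` `]x, +oo[.
    by apply/seteqP; split => w /=; rewrite in_itv/= andbT.
  by rewrite -[X in measurable X]setTI; exact: mX.
have -> : P [set w | x < X w] = (\int[P]_w ((x < X w)%R%:R)%:E)%E.
  rewrite -[X in P X]setIT -integral_indic//; apply: eq_integral => w _.
  rewrite indicE; congr (_%:R%:E); case: ltP => h; first by rewrite mem_set.
  by rewrite memNset//= => /lt_geF; rewrite h.
apply: (dominated_cvg measurableT _ _ _ i1) => //.
- move=> m; apply/measurable_EFinP; apply: measurable_funX; apply: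
    measurable_funB => //.
- by move=> w _; apply: cvg_EFin; [exact: nearW|exact: cvg_laplace_step].
- move=> m w _; have /andP[h0 h1] := laplace_step01 x m (X0 w).
  by rewrite /= lee_fin ger0_norm.
Qed.

End one_variable.

(** A tail probability is the limit of the integrals of [laplace_step], which the binomial formula
    expresses by values of the Laplace transform at multiples of m. *)
Lemma laplace_tails d d' (T : measurableType d) (T' : measurableType d')
  (P : probability T R) (Q : probability T' R) (X : T -> R) (Y : T' -> R) :
  measurable_fun setT X -> measurable_fun setT Y ->
  (forall w, 0 <= X w) -> (forall w, 0 <= Y w) ->
  (forall s, 0 < s -> laplace P X s = laplace Q Y s) ->
  forall x, P [set w | x < X w] = Q [set w | x < Y w].
Proof.
move=> mX mY X0 Y0 L x; have [x0|x0] := ltP x 0.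
  have -> : [set w | x < X w] = setT by apply/seteqP; split => // w _ /=; exact:
    lt_le_trans (X0 w).
  have -> : [set w | x < Y w] = setT by apply/seteqP; split => // w _ /=; exact:
    lt_le_trans (Y0 w).
  by rewrite !probability_setT.
(* The binomial expansion also involves s = 0, where both transforms equal the total mass 1. *)
have L' s : 0 <= s -> laplace P X s = laplace Q Y s.
  rewrite le_eqVlt => /predU1P[<-|/L//]; rewrite /laplace.
  under eq_Rintegral do rewrite mul0r oppr0 expR0.
  under [RHS]eq_Rintegral do rewrite mul0r oppr0 expR0.
  rewrite !Rintegral_cst// !mul1r.
  exact: etrans (congr1 fine (probability_setT P))
    (esym (congr1 fine (probability_setT Q))).
have hP := cvg_integral_laplace_step mX X0 x0 (P := P).
have hQ := cvg_integral_laplace_step mY Y0 x0 (P := Q).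
apply: (cvg_unique _ hP) => //=; apply: cvg_trans hQ.
apply: near_eq_cvg; near=> m.
rewrite !integral_laplace_step//; congr EFin; apply: eq_bigr => i _.
by rewrite L'// mulr_ge0.
Unshelve. all: by end_near. Qed.

End laplace_transform_uniqueness.

Lemma le_powR_root (R : realType) (a x z : R) : 0 < a -> 0 <= x -> 0 <= z ->
  (x <= z `^ a) = (x `^ a^-1 <= z).
Proof.
move=> a0 x0 z0; apply/idP/idP => h.
  have := ge0_ler_powR (ltW (_ : 0 < a^-1)) _ _ h.
  rewrite -powRrM mulfV ?gt_eqF// powRr1//; apply; rewrite ?invr_gt0//
    ?nnegrE//.
  exact: powR_ge0.
have := ge0_ler_powR (ltW a0) _ _ h.
rewrite -powRrM mulVf ?gt_eqF// powRr1//; apply; rewrite ?nnegrE//.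
exact: powR_ge0.
Qed.

Lemma measurable_lt_set d (T : measurableType d) (R : realType) (X : T -> R)
  (x : R) :
  measurable_fun setT X -> measurable [set w | x < X w].
Proof.
move=> mX; have -> : [set w | x < X w] = X @^-1` `]x, +oo[.
  by apply/seteqP; split => w /=; rewrite in_itv/= andbT.
by rewrite -[X in measurable X]setTI; exact: mX.
Qed.

Lemma measurable_le_set d (T : measurableType d) (R : realType) (X : T -> R)
  (x : R) :
  measurable_fun setT X -> measurable [set w | X w <= x].
Proof.
move=> mX; have -> : [set w | X w <= x] = ~` [set w | x < X w].
  by apply/seteqP; split => w /=;
    [rewrite leNgt => /negP|move/negP; rewrite -leNgt].
by apply: measurableC; exact: measurable_lt_set.
Qed.

(** The indicator of X <= s is at most exp(p (s - X)): the exponential Markov inequality for a lower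
    tail. *)
Lemma laplace_markov d (T : measurableType d) (R : realType)
  (P : probability T R)
    (X : T -> R) (p s : R) :
  measurable_fun setT X -> (forall w, 0 <= X w) -> 0 <= p ->
  (P [set w | (X w <= s)%R] <= (expR (p * s) * laplace P X p)%:E)%E.
Proof.
move=> mX X0 p0.
have mE : measurable_fun setT (fun w => expR (- (p * X w))).
  by apply: measurableT_comp => //; apply: measurableT_comp => //; exact:
    measurable_funM.
have fE : (\int[P]_w (expR (- (p * X w)))%:E)%E \is a fin_num.
  by apply: integrable_fin_num => //; exact: integrable_laplace.
rewrite EFinM fineK//.
have mE' : measurable_fun setT (fun w => (expR (- (p * X w)))%:E).
  exact/measurable_EFinP.
rewrite -(ge0_integralZl P measurableT mE' (k := (expR (p * s))%:E));
  last 2 first.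
- by move=> w _; rewrite lee_fin expR_ge0.
- by rewrite lee_fin expR_ge0.
rewrite -[X in P X]setIT -integral_indic//; last exact: measurable_le_set.
apply: ge0_le_integral => //.
- by apply/measurable_EFinP; apply: measurable_indic; exact: measurable_le_set.
- by apply/measurable_EFinP; exact: measurable_funM.
move=> w _; rewrite -EFinM -expRD lee_fin indicE.
case: (boolP (_ \in _)) => [|_]; last exact: expR_ge0.
rewrite inE /= => h; rewrite -[leLHS]expR0 ler_expR.
by rewrite subr_ge0 ler_wpM2l.
Qed.

(** * The inverse of a nondecreasing process *)

Section inverse_process.
Context d (T : measurableType d) (R : realType) (P : probability T R).
Variables (D : R -> T -> R).
Hypothesis D_mono : forall w s t, 0 <= s -> s <= t -> D s w <= D t w.
Local Notation Y := (inverse_process D).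

Let E t w := [set x | 0 <= x /\ t < D x w].

Let lbE t w : lbound (E t w) 0. Proof. by move=> x []. Qed.

Let inv0 t w : ~ (E t w !=set0) -> Y t w = 0.
Proof.
move=> /set0P/negP; rewrite negbK => /eqP e.
by rewrite /inverse_process -/(E t w) e inf0.
Qed.

Lemma inverse_process_ge0 t w : 0 <= Y t w.
Proof.
have [ne|/inv0 ->//] := pselect (E t w !=set0).
exact: lb_le_inf ne (@lbE t w).
Qed.

(** By monotonicity of D, countably many times decide x < Y, which yields measurability. The first
    condition says that D exceeds t at some time; otherwise Y is the infimum of the empty set, which
    is 0 by convention. *)
Lemma lt_inverse_process t w x : 0 <= x -> x < Y t w <->
  (exists n : nat, t < D n%:R w) /\ (exists n : nat, D (x + n.+1%:R^-1) w <= t).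
Proof.
move=> x0; split.
  move=> xY; have [ne|/inv0 e] := pselect (E t w !=set0); last first.
    by move: xY; rewrite e ltNge x0.
  split.
    have [q [q0 qt]] := ne; exists (Num.truncn q).+1.
    by apply: lt_le_trans qt _; apply: D_mono => //; rewrite ltW// truncnS_gt.
  have [n xn] := ltr_add_invr xY; exists n.
  rewrite leNgt; apply/negP => h; move: xn; apply/negP; rewrite -leNgt.
  apply: ge_inf; first by exists 0; exact: lbE.
  by split => //; rewrite addr_ge0// invr_ge0.
move=> [[m tm] [n nt]].
apply: (@lt_le_trans _ _ (x + n.+1%:R^-1)); first by rewrite ltrDl.
apply: lb_le_inf; first by exists m%:R.
move=> q [q0 qt]; rewrite leNgt; apply/negP => qx.
by have := lt_le_trans qt (D_mono w q0 (ltW qx)); rewrite ltNge nt.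
Qed.

(** Some q < Y t + e satisfies D q > t, and then D q exceeds every level t' close enough to t. If D
    never exceeds t, the infima at t and at t' are both over the empty set. *)
Lemma inverse_process_right_continuous w t (e : R) : 0 < e ->
  \forall t' \near t^'+, Y t w <= Y t' w < Y t w + e.
Proof.
move=> e0; have [ne|h] := pselect (E t w !=set0); last first.
  near=> t'; have tt' : t < t' by near: t'; exact: nbhs_right_gt.
  rewrite (inv0 h) (@inv0 t' w) ?lexx ?add0r// => -[x [x0 xt']]; apply: h.
  by exists x; split => //; exact: lt_trans xt'.
have hi : has_inf (E t w) by split => //; exists 0; exact: lbE.
have [q [q0 qt] qe] := inf_adherent e0 hi.
near=> t'.
have tt' : t < t' by near: t'; exact: nbhs_right_gt.
have t'q : t' < D q w by near: t'; exact: nbhs_right_lt.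
apply/andP; split.
  apply: lb_le_inf; first by exists q.
  move=> x [x0 xt']; apply: ge_inf; first by exists 0; exact: lbE.
  by split => //; exact: lt_trans xt'.
apply: le_lt_trans qe; apply: ge_inf; first by exists 0; exact: lbE.
by split.
Unshelve. all: by end_near. Qed.

Hypothesis mD : forall t, 0 <= t -> measurable_fun setT (D t).

Let lt_inverse_set t x : 0 <= x -> [set w | x < Y t w] =
  (\bigcup_n [set w | t < D n%:R w]) `&`
    (\bigcup_n [set w | D (x + n.+1%:R^-1) w <= t]).
Proof.
move=> x0; apply/seteqP; split => w /=.
  by move/(lt_inverse_process _ _ x0) => [[m ?] [n ?]]; split;
    [exists m|exists n].
by move=> [[m _ ?] [n _ ?]]; apply/(lt_inverse_process _ _ x0); split;
  [exists m|exists n].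
Qed.

Lemma measurable_inverse_process t : measurable_fun setT (Y t).
Proof.
apply: (measurability (@RGenOInfty.G R)); first exact: RGenOInfty.measurableE.
move=> _ [_ [x ->] <-]; rewrite setTI.
have -> : Y t @^-1` `]x, +oo[ = [set w | x < Y t w].
  by apply/seteqP; split => w /=; rewrite in_itv/= andbT.
have [x0|x0] := ltP x 0.
  have -> : [set w | x < Y t w] = setT.
    by apply/seteqP; split => // w _ /=; exact:
      lt_le_trans (inverse_process_ge0 _ _).
  exact: measurableT.
rewrite lt_inverse_set//; apply: measurableI; apply: bigcup_measurable => n _.
  by apply: measurable_lt_set; exact: mD.
by apply: measurable_le_set; apply: mD; rewrite addr_ge0 ?invr_ge0.
Qed.

End inverse_process.

Lemma expectation_Rintegral d (T : measurableType d) (R : realType)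
  (P : probability T R)
  (X : T -> R) : fine 'E_P[X]%E = \int[P]_w X w.
Proof. by rewrite unlock. Qed.

(** * The stable subordinator and the law of its inverse *)

Section stable_subordinator.
Context d (T : measurableType d) (R : realType) (P : probability T R).
Variables (alpha : R) (D : R -> T -> R).
Hypothesis alpha_gt0 : 0 < alpha.
Hypothesis hD : stable_subordinator P alpha D.
Local Notation Y := (inverse_process D).

Lemma stable_measurable t : 0 <= t -> measurable_fun setT (D t).
Proof. by have [_ [+ _ _ _ _] _ _] := hD; apply. Qed.

Lemma stable_ge0 w s : 0 <= s -> 0 <= D s w.
Proof. by move=> s0; have [_ _ /(_ w s s s0 (lexx _))[]] := hD. Qed.

Lemma stable_mono w s t : 0 <= s -> s <= t -> D s w <= D t w.
Proof. by move=> s0 st; have [_ _ /(_ w s t s0 st)[]] := hD. Qed.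

Let m1 := stable_measurable ler01.
Let ge1 w := stable_ge0 w ler01.

Lemma stable_laplace s t : 0 < s -> 0 <= t ->
  laplace P (D t) s = expR (- (t * s `^ alpha)).
Proof.
move=> s0 t0; have [_ _ _ /(_ s t s0 t0) h] := hD.
rewrite /laplace -expectation_Rintegral.
under [X in expectation _ X]eq_fun do rewrite -mulNr.
by rewrite h /= mulNr.
Qed.

(** Both variables have the Laplace transform exp(- q s^alpha); for the right one, that of D 1 is
    taken at s q^(1/alpha). *)
Lemma stable_scaling q x : 0 <= q ->
  P [set w | x < D q w] = P [set w | x < q `^ alpha^-1 * D 1 w].
Proof.
move=> q0; apply: laplace_tails.
- exact: stable_measurable.
- exact: measurable_funM.
- by move=> w; exact: stable_ge0.
- by move=> w; rewrite mulr_ge0 ?powR_ge0// stable_ge0.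
move=> s s0; rewrite stable_laplace//.
move: q0; rewrite le_eqVlt => /predU1P[<-|q0].
  rewrite powR0 ?invr_eq0 ?gt_eqF// mul0r oppr0 expR0 /laplace.
  under eq_Rintegral do rewrite mul0r mulr0 oppr0 expR0.
  by rewrite Rintegral_cst// mul1r;
    exact/esym/(congr1 fine (probability_setT P)).
have -> : laplace P (fun w => q `^ alpha^-1 * D 1 w) s = laplace P (D 1)
  (s * q `^ alpha^-1).
  by apply: eq_Rintegral => w _; rewrite mulrA.
rewrite stable_laplace ?mulr_gt0 ?powR_gt0// mul1r powRM ?powR_ge0 ?ltW//.
by rewrite -powRrM mulVf ?gt_eqF// powRr1 ?ltW// mulrC.
Qed.

Lemma stable_le_scaling q x : 0 <= q ->
  P [set w | D q w <= x] = P [set w | q `^ alpha^-1 * D 1 w <= x].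
Proof.
move=> q0.
have E (X : T -> R) : [set w | X w <= x] = ~` [set w | x < X w].
  by apply/seteqP; split => w /=;
    [rewrite leNgt => /negP|move/negP; rewrite -leNgt].
rewrite !E !probability_setC ?stable_scaling//.
- by apply: measurable_lt_set; exact: measurable_funM.
- by apply: measurable_lt_set; exact: stable_measurable.
Qed.

Lemma cvg_expRN_mule (c : R) : (expR (c - n%:R))%:E @[n --> \oo] --> 0%E.
Proof.
apply: cvg_EFin; first exact: nearW.
have : expR c * expR (- (n%:R : R)) @[n --> \oo] --> expR c * 0.
  by apply: cvgM; [exact: cvg_cst|exact: cvg_expRN].
by rewrite mulr0; apply: cvg_trans; apply: near_eq_cvg; near=> n;
  rewrite -expRD.
Unshelve. all: by end_near. Qed.

(** [laplace_markov] with p = 1 gives P(D n <= t) <= exp(t - n) for every n. *)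
Lemma stable_unbounded t : P [set w | forall n : nat, D n%:R w <= t] = 0%E.
Proof.
apply/eqP; rewrite eq_le measure_ge0 andbT.
apply: (cvge_ge _ (cvg_expRN_mule t)); apply: nearW => n.
apply: (@le_trans _ _ (P [set w | D n%:R w <= t])).
  apply: le_measure; rewrite ?inE.
  - have -> : [set w | forall n : nat, D n%:R w <= t] = \bigcap_n
      [set w | D n%:R w <= t].
      by apply/seteqP; split => w /=;
        [move=> h m _; exact: h|move=> h m; exact: h].
    apply: bigcapT_measurable => m; apply: measurable_le_set.
    exact: stable_measurable.
  - by apply: measurable_le_set; exact: stable_measurable.
  - by move=> w; exact.
have := laplace_markov P t (stable_measurable (ler0n R n))
  (fun w => stable_ge0 w (ler0n R n)) ler01.
rewrite stable_laplace// powR1 mulr1 mul1r -expRD; exact.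
Qed.

(** [laplace_markov] at level 0 with p = n^(1/alpha) gives the bound exp(- n). Positivity makes the
    quotient t / D 1 meaningful almost surely. *)
Lemma stable_gt0 : P [set w | D 1 w <= 0] = 0%E.
Proof.
apply/eqP; rewrite eq_le measure_ge0 andbT.
apply: (cvge_ge _ (cvg_expRN_mule 0)).
exists 1%N => // n /= n1; have n0 : (0 : R) < n%:R by rewrite ltr0n.
have p0 : 0 < n%:R `^ alpha^-1 :> R by rewrite powR_gt0.
have := laplace_markov P 0 m1 ge1 (ltW p0).
by rewrite stable_laplace// mulr0 expR0 !mul1r -powRrM mulVf ?gt_eqF// powRr1
  ?(ltW n0)//= sub0r.
Qed.

Lemma measurable_stable_ratio t : measurable_fun setT
  (fun w => (t / D 1 w) `^ alpha).
Proof.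
apply: (measurableT_comp (measurable_powR alpha)).
have := measurable_funM (measurable_cst t)
  (measurableT_comp (measurable_powR (-1)) m1).
by apply: eq_measurable_fun => w _ /=; rewrite powR_inv1// stable_ge0.
Qed.

(* The inverse process has the law of [(t / D 1) `^ alpha], since [D q] has that
   of [q `^ alpha^-1 * D 1]. *)
Lemma inverse_stable_tails t x : 0 <= t ->
  P [set w | x < Y t w] = P [set w | x < (t / D 1 w) `^ alpha].
Proof.
move=> t0; have [x0|x0] := ltP x 0.
  have -> : [set w | x < Y t w] = setT.
    by apply/seteqP; split => // w _ /=; exact:
      lt_le_trans (inverse_process_ge0 _ _ _).
  by congr (P _); apply/esym/seteqP; split => // w _ /=; exact:
    lt_le_trans (powR_ge0 _ _).
(* Scaling compares laws at a single fixed time, so the event x < Y is exhausted by the increasing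
   events D (x + 1 / (n + 1)) <= t, and continuity of the measure passes to the union. *)
pose xn n : R := x + n.+1%:R^-1.
have xn0 n : 0 <= xn n by rewrite addr_ge0 ?invr_ge0.
have xn_le n m : (n <= m)%N -> xn m <= xn n.
  by move=> nm; rewrite lerD2l lef_pV2 ?posrE ?ltr0n// ler_nat.
pose B n := [set w | D (xn n) w <= t].
pose C n := [set w | xn n `^ alpha^-1 * D 1 w <= t].
have mB n : measurable (B n) by apply: measurable_le_set; exact:
  stable_measurable.
have mC n : measurable (C n) by apply: measurable_le_set; exact:
  measurable_funM.
have PBC : P (\bigcup_n B n) = P (\bigcup_n C n).
  have hB : P (B n) @[n --> \oo] --> P (\bigcup_n B n).
    apply: nondecreasing_cvg_mu => //; first exact: bigcup_measurable.
    move=> n m nm; apply/subsetPset => w; apply: le_trans.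
    by apply: stable_mono => //; exact: xn_le.
  have hC : P (C n) @[n --> \oo] --> P (\bigcup_n C n).
    apply: nondecreasing_cvg_mu => //; first exact: bigcup_measurable.
    move=> n m nm; apply/subsetPset => w; apply: le_trans.
    rewrite ler_wpM2r ?stable_ge0//; apply: ge0_ler_powR; rewrite ?nnegrE
      ?invr_ge0 ?(ltW alpha_gt0)//.
    exact: xn_le.
  apply: (cvg_unique _ hB) => //=; apply: cvg_trans hC.
  by apply: near_eq_cvg; near=> n; rewrite /B /C stable_le_scaling.
have mN1 : measurable [set w | forall n : nat, D n%:R w <= t].
  have -> : [set w | forall n : nat, D n%:R w <= t] = \bigcap_n
    [set w | D n%:R w <= t].
    by apply/seteqP; split => w /=;
      [move=> h m _; exact: h|move=> h m; exact: h].
  by apply: bigcapT_measurable => m; apply: measurable_le_set; exact: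
    stable_measurable.
have mN2 : measurable [set w | D 1 w <= 0] by exact: measurable_le_set.
have mY := measurable_inverse_process stable_mono stable_measurable t.
transitivity (P (\bigcup_n B n)).
  (* The null event where D never exceeds t is added to both sides: on it the union holds, whereas Y
     is 0. *)
  rewrite -[LHS](measureU0 (mu := P) (measurable_lt_set x mY) mN1
    (stable_unbounded t)).
  rewrite -[RHS](measureU0 (mu := P) (bigcup_measurable (fun n _ => mB n)) mN1
    (stable_unbounded t)).
  congr (P _); apply/seteqP; split => w /=.
    move=> [|h]; last by right.
    by move/(lt_inverse_process stable_mono _ _ x0) => [_ [n ?]]; left;
      exists n.
  move=> [[n _ hn]|h]; last by right.
  have [h|h] := pselect (forall n : nat, D n%:R w <= t); first by right.
  left; apply/(lt_inverse_process stable_mono _ _ x0); split; last by exists n.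
  by move/existsNP: h => [m /negP]; rewrite -ltNge => ?; exists m.
rewrite PBC.
(* Likewise for the null event D 1 <= 0, on which the quotient is a division by 0. *)
rewrite -[LHS](measureU0 (mu := P) (bigcup_measurable (fun n _ => mC n)) mN2
  stable_gt0).
rewrite -[RHS](measureU0 (mu := P)
  (measurable_lt_set x (measurable_stable_ratio t)) mN2 stable_gt0).
congr (P _); apply/seteqP; split => w /=.
  move=> [[n _ hn]|h]; last by right.
  have [h|D0] := leP (D 1 w) 0; first by right.
  left; apply: (@lt_le_trans _ _ (xn n)); first by rewrite ltrDl.
  by rewrite (le_powR_root alpha_gt0 (xn0 n) (divr_ge0 t0 (ltW D0)))
    ler_pdivlMr.
move=> [h|h]; last by right.
have [?|D0] := leP (D 1 w) 0; first by right.
left; have [n /ltW hn] := ltr_add_invr h; exists n => //=.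
by move: hn; rewrite (le_powR_root alpha_gt0 (xn0 n) (divr_ge0 t0 (ltW D0)))
  ler_pdivlMr.
Unshelve. all: by end_near. Qed.

End stable_subordinator.

(** * Gamma integrals and the layer-cake formula *)

Section gamma_integrals.
Variable R : realType.
Local Notation mu := (@lebesgue_measure R).

Lemma is_derive_Xn n (x : R) :
  is_derive x (1 : R) (fun v : R => v ^+ n.+1) (n.+1%:R * x ^+ n).
Proof.
have -> : (fun v : R => v ^+ n.+1) = (id ^+ n.+1 : R -> R).
  by apply/funext => v; elim: (n.+1) => [//|m IH]; rewrite exprS IH
    [in RHS]exprS.
have h : is_derive x (1 : R) (id : R -> R) (1 : R) by exact: is_derive_id.
apply: (is_derive_eq (is_deriveX n.+1 h)).
by rewrite /GRing.scale /= mulr1.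
Qed.

Lemma cvg_Xn_expRN n : (x ^+ n * expR (- x)) @[x --> +oo%R] --> (0 : R).
Proof.
apply/cvgrPdist_le => e e0; near=> x.
have x0 : 0 < x by near: x; exact: nbhs_pinfty_gt.
rewrite sub0r normrN ger0_norm; last by rewrite mulr_ge0 ?exprn_ge0 ?expR_ge0
  ?(ltW x0).
rewrite expRN ler_pdivrMr ?expR_gt0//.
have h := expR_ge1Dxn n (ltW x0).
have f0 : (0 : R) < (n.+1)`!%:R by rewrite ltr0n fact_gt0.
have hx : (n.+1)`!%:R <= e * x by rewrite -ler_pdivrMl//; near: x; apply:
  nbhs_pinfty_ge; rewrite num_real.
have {}h : x ^+ n.+1 <= expR x * (n.+1)`!%:R.
  by rewrite -ler_pdivrMr//; apply: le_trans h; rewrite lerDr.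
have : x ^+ n * x <= e * expR x * x.
  rewrite -exprSr; apply: le_trans h _; rewrite mulrAC mulrC ler_wpM2r
    ?expR_ge0//.
by rewrite ler_pM2r.
Unshelve. all: by end_near. Qed.

(** The primitive of x^n exp(- x) given by repeated integration by parts. *)
Fixpoint gamma_primitive n (x : R) : R :=
  if n is m.+1 then - (x ^+ n * expR (- x)) + n%:R * gamma_primitive m x
  else - expR (- x).

Lemma is_derive_gamma_primitive n (x : R) :
  is_derive x (1 : R) (gamma_primitive n) (x ^+ n * expR (- x)).
Proof.
have dE (y : R) : is_derive y (1:R) (fun x : R => expR (- x)) (- expR (- y)).
  apply: is_derive_eq; by rewrite /GRing.scale /=; ring.
elim: n => [|n IH] /=.
  apply: is_derive_eq; rewrite expr0 /GRing.scale /=; ring.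
move: IH; move: (gamma_primitive n) => F IH.
have h1 : is_derive x (1:R) (fun x0 : R => x0 ^+ n.+1 * expR (- x0))
   (n.+1%:R * x ^+ n * expR (- x) - x ^+ n.+1 * expR (- x)).
  by apply: (is_derive_eq (is_deriveM (is_derive_Xn n x) (dE x)));
    rewrite /GRing.scale /=; ring.
have h2 : is_derive x (1:R) (fun x0 : R => n.+1%:R * F x0)
  (n.+1%:R * (x ^+ n * expR (- x))).
  exact: is_deriveZ.
apply: (is_derive_eq (is_deriveD (is_deriveN h1) h2)).
by ring.
Qed.

Lemma gamma_primitive0 n : gamma_primitive n 0 = - n`!%:R.
Proof.
elim: n => [|n IH] /=; first by rewrite oppr0 expR0.
by rewrite IH expr0n mul0r oppr0 add0r factS natrM mulrN.
Qed.

Lemma cvg_gamma_primitive n : gamma_primitive n x @[x --> +oo%R] --> (0 : R).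
Proof.
elim: n => [|n IH] /=.
  by rewrite -oppr0; apply: cvgN; exact: cvgr_expR.
rewrite -[X in _ --> X](addr0 0); apply: cvgD.
  by rewrite -oppr0; apply: cvgN; exact: cvg_Xn_expRN.
by rewrite -(mulr0 n.+1%:R); apply: cvgM => //; exact: cvg_cst.
Qed.

Lemma integral_Xn_expRN n (c : R) : 0 <= c ->
  (\int[mu]_(x in `[c, +oo[) (x ^+ n * expR (- x))%:E =
    (- gamma_primitive n c)%:E)%E.
Proof.
move=> c0.
have cont (x : R) : {for x, continuous (fun x : R => x ^+ n * expR (- x))}.
  apply: cvgM; first exact: exprn_continuous.
  by apply: (@continuous_comp _ _ _ (-%R) expR);
    [exact: opp_continuous|exact: continuous_expR].
rewrite (@ge0_continuous_FTC2y _ _ (gamma_primitive n) c 0).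
- by rewrite sub0e.
- by move=> x cx; rewrite mulr_ge0 ?expR_ge0// exprn_ge0// (le_trans c0).
- by apply: continuous_subspaceT => x; exact: cont.
- exact: cvg_gamma_primitive.
- by move=> x _; have [] := is_derive_gamma_primitive n x.
- apply: cvg_at_right_filter; apply: differentiable_continuous;
    apply/derivable1_diffP.
  by have [] := is_derive_gamma_primitive n c.
- move=> x _; rewrite derive1E; have h := is_derive_gamma_primitive n x.
  by have [_ ->] := h.
Qed.

Lemma measurable_Xn_expRN n (A : set R) : measurable_fun A
  (fun x : R => (x ^+ n * expR (- x))%:E).
Proof.
apply/measurable_EFinP; apply: measurable_funTS; apply: measurable_funM.
  exact: measurable_funX.
by apply: measurableT_comp => //.
Qed.

Lemma integral_gamma_fact n :
  (\int[mu]_(x in `]0%R, +oo[) (x ^+ n * expR (- x))%:E = n`!%:R%:E)%E.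
Proof.
rewrite integral_itv_obnd_cbnd; last exact: measurable_Xn_expRN.
by rewrite integral_Xn_expRN// gamma_primitive0 opprK.
Qed.

Lemma integral_expRN_tail (c : R) : 0 <= c ->
  (\int[mu]_(x in `]c, +oo[) (expR (- x))%:E = (expR (- c))%:E)%E.
Proof.
move=> c0.
transitivity (\int[mu]_(x in `]c, +oo[) (x ^+ 0 * expR (- x))%:E)%E.
  by apply: eq_integral => x _; rewrite expr0 mul1r.
rewrite integral_itv_obnd_cbnd; last exact: measurable_Xn_expRN.
by rewrite integral_Xn_expRN//= opprK.
Qed.

Lemma integral_Xn_itv n (V : R) : 0 < V ->
  (\int[mu]_(v in `]0%R, V[) (n.+1%:R * v ^+ n)%:E = (V ^+ n.+1)%:E)%E.
Proof.
move=> V0.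
have dX := is_derive_Xn n.
have cX (x : R) : {for x, continuous (fun v : R => v ^+ n.+1)}.
  by apply: differentiable_continuous; apply/derivable1_diffP; have [] := dX x.
rewrite -(integral_itv_bndoo true false); last first.
  by apply/measurable_EFinP; apply: measurable_funTS; apply: measurable_funM =>
    //; exact: measurable_funX.
rewrite (@continuous_FTC2 _ _ (fun v : R => v ^+ n.+1))//.
- by rewrite expr0n /= sube0.
- by apply: continuous_subspaceT => x; apply: cvgM;
    [exact: cvg_cst|exact: exprn_continuous].
- split.
  + by move=> x _; have [] := dX x.
  + by apply: cvg_at_right_filter; exact: cX.
  + by apply: cvg_at_left_filter; exact: cX.
- by move=> x _; rewrite derive1E; have [_ ->] := dX x.
Qed.

End gamma_integrals.

Lemma measurable_natr_bool d (T : measurableType d) (R : realType)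
  (b : T -> bool) :
  measurable_fun setT b -> measurable_fun setT (fun w => (b w)%:R : R).
Proof. by move=> mb; apply:
  (@measurableT_comp _ _ _ _ _ _ (fun c : bool => c%:R : R)). Qed.

Lemma root_lt_powR (R : realType) (a x z : R) : 0 < a -> 0 <= x -> 0 <= z ->
  (x < z `^ a) = (x `^ a^-1 < z).
Proof.
move=> a0 x0 z0; apply/idP/idP; rewrite !ltNge; apply: contra => h.
  by move: h; rewrite le_powR_root ?invr_gt0// invrK.
by rewrite le_powR_root ?invr_gt0// invrK.
Qed.

Section layer_cake.
Variable R : realType.
Local Notation mu := (@lebesgue_measure R).
Variables (alpha : R).
Hypothesis alpha_gt0 : 0 < alpha.

(** With V = (x / y)^alpha, V^(n+1) is the integral of (n + 1) v^n over ]0, V[. After the exchange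
    of integrals, v < V reads v^(1/alpha) y < x, and exp(- x) integrates over that half-line to
    exp(- v^(1/alpha) y), the integrand of a Laplace transform when y = D 1. *)
Lemma integral_powR_expRN (y : R) n : 0 < y ->
  (\int[mu]_(x in `]0%R, +oo[) (((x / y) `^ alpha) ^+ n.+1 * expR (- x))%:E =
   \int[mu]_(v in `]0%R, +oo[)
     (n.+1%:R * v ^+ n * expR (- (v `^ alpha^-1 * y)))%:E)%E.
Proof.
move=> y0.
pose b (x v : R) := [&& 0 < x, 0 < v & v < (x / y) `^ alpha].
pose F (z : (measurableTypeR R * measurableTypeR R)%type) : \bar R :=
  ((b z.1 z.2)%:R * (n.+1%:R * z.2 ^+ n * expR (- z.1)))%:E.
have mF : measurable_fun setT F.
  apply/measurable_EFinP; apply: measurable_funM.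
    apply: measurable_natr_bool; apply: measurable_and; first exact:
      measurable_fun_ltr.
    apply: measurable_and; first exact: measurable_fun_ltr.
    apply: measurable_fun_ltr => //.
    apply: (measurableT_comp (measurable_powR alpha)).
    by apply: measurable_funM => //.
  apply: measurable_funM.
    by apply: measurable_funM => //; apply: measurable_funX.
  by apply: measurableT_comp => //; apply: measurableT_comp.
have F0 z : (0 <= F z)%E.
  rewrite lee_fin /b; case: (ltP 0 z.2) => h; last by rewrite andbF mul0r.
  by rewrite mulr_ge0// mulr_ge0 ?expR_ge0// mulr_ge0// exprn_ge0// ltW.
transitivity (\int[mu]_x fubini_F mu F x)%E.
  rewrite /fubini_F; apply/esym.
  rewrite [RHS]integral_mkcond; apply: eq_integral => x _; rewrite patchE
    mem_setE in_itv/= andbT.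
  case: ifPn => x0; last first.
    by apply: integral0_eq => v _; rewrite /F /b /= (negbTE x0) mul0r.
  have V0 : 0 < (x / y) `^ alpha by rewrite powR_gt0// divr_gt0.
  rewrite [in RHS]mulrC EFinM -(integral_Xn_itv n V0) -ge0_integralZl//;
    last 2 first.
  - by apply/measurable_EFinP; apply: measurable_funTS; apply: measurable_funM
      => //; exact: measurable_funX.
  - move=> v; rewrite /= in_itv/= => /andP[v0 _].
    by rewrite lee_fin mulr_ge0// exprn_ge0// ltW.
  rewrite [RHS]integral_mkcond; apply: eq_integral => v _; rewrite patchE
    mem_setE in_itv/=.
  rewrite /F /b /= x0 /=; case: ifPn => h; last by rewrite mul0r.
  by rewrite mul1r -EFinM mulrC.
rewrite (fubini_tonelli F mF F0) /fubini_G [RHS]integral_mkcond.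
apply: eq_integral => v _; rewrite patchE mem_setE in_itv/= andbT.
case: ifPn => v0; last first.
  by apply: integral0_eq => x _; rewrite /F /b /= (negbTE v0) andbF mul0r.
have c0 : 0 <= v `^ alpha^-1 * y by rewrite mulr_ge0 ?powR_ge0// ltW.
rewrite EFinM -(integral_expRN_tail c0) -ge0_integralZl//; last 2 first.
- by apply/measurable_EFinP; apply: measurable_funTS; apply: measurableT_comp =>
    //.
- by rewrite lee_fin mulr_ge0// exprn_ge0// ltW.
rewrite [RHS]integral_mkcond; apply: eq_integral => x _; rewrite patchE mem_setE
  in_itv/= andbT /F /=.
have -> : b x v = (v `^ alpha^-1 * y < x).
  rewrite /b v0 /=; have [x0|x0] := ltP 0 x.
    by rewrite /= root_lt_powR// ?(ltW v0) ?divr_ge0 ?ltW// ltr_pdivlMr.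
  by apply/esym/negbTE; rewrite -leNgt (le_trans x0).
case: ifPn => h; last by rewrite mul0r.
by rewrite mul1r -EFinM.
Qed.

End layer_cake.

(** * Negative moments of the stable subordinator *)

Section stable_moment.
Context d (T : measurableType d) (R : realType) (P : probability T R).
Local Notation mu := (@lebesgue_measure R).
Variables (alpha : R) (D : R -> T -> R).
Hypothesis alpha_gt0 : 0 < alpha.
Hypothesis hD : stable_subordinator P alpha D.

Let mD1 : measurable_fun setT (D 1). Proof. exact: (stable_measurable hD ler01).
  Qed.
Let D1ge0 w : 0 <= D 1 w. Proof. exact: (stable_ge0 hD). Qed.

Lemma measurable_stable_inverse_pow b :
  measurable_fun setT (fun w => (D 1 w)^-1 `^ b).
Proof.
have := measurableT_comp (measurable_powR b)
  (measurableT_comp (measurable_powR (-1)) mD1).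
by apply: eq_measurable_fun => w _ /=; rewrite powR_inv1.
Qed.

Let F n (z : (T * measurableTypeR R)%type) : \bar R :=
  (((0 < z.2)%R%:R) * (n.+1%:R * z.2 ^+ n * expR
    (- (z.2 `^ alpha^-1 * D 1 z.1))))%:E.

Let mF n : measurable_fun setT (F n).
Proof.
apply/measurable_EFinP; apply: measurable_funM.
  by apply: measurable_natr_bool; exact: measurable_fun_ltr.
apply: measurable_funM.
  by apply: measurable_funM => //; apply: measurable_funX.
apply: measurableT_comp => //; apply: measurableT_comp => //.
apply: measurable_funM; last exact: (measurableT_comp mD1).
exact: (measurableT_comp (measurable_powR _)).
Qed.

Let F0 n z : (0 <= F n z)%E.
Proof.
rewrite lee_fin; case: (ltP 0 z.2) => h; last by rewrite mul0r.
by rewrite mul1r mulr_ge0 ?expR_ge0// mulr_ge0// exprn_ge0// ltW.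
Qed.

Let fubini_FE n w :
  (\int[mu]_(v in `]0%R, +oo[)
    (n.+1%:R * v ^+ n * expR (- (v `^ alpha^-1 * D 1 w)))%:E)%E =
  fubini_F mu (F n) w.
Proof.
rewrite integral_mkcond; apply: eq_integral => v _.
rewrite patchE mem_setE in_itv/= andbT /F /=.
by case: ifPn => h; rewrite ?mul1r ?mul0r.
Qed.

(** Integrating over the sample space first, E exp(- v^(1/alpha) D 1) = exp(- v), and a factorial
    Gamma integral remains. *)
Let integral_stable_exp n : (\int[P]_w fubini_F mu (F n) w = (n.+1)`!%:R%:E)%E.
Proof.
rewrite (fubini_tonelli (F n) (mF n) (F0 n)) /fubini_G.
rewrite factS natrM EFinM -(integral_gamma_fact R n) -ge0_integralZl//;
  last 2 first.
- exact: measurable_Xn_expRN.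
- move=> v; rewrite /= in_itv/= andbT => v0.
  by rewrite lee_fin mulr_ge0 ?expR_ge0// exprn_ge0// ltW.
rewrite [RHS]integral_mkcond; apply: eq_integral => v _.
rewrite patchE mem_setE in_itv/= andbT /F /=; case: ifPn => v0; last first.
  by apply: integral0_eq => w _; rewrite mul0r.
under eq_integral do rewrite mul1r EFinM.
have iL : P.-integrable setT (fun w => (expR (- (v `^ alpha^-1 * D 1 w)))%:E).
  by have := integrable_laplace P mD1 D1ge0 (powR_ge0 v alpha^-1).
rewrite integralZl//.
have := stable_laplace hD (powR_gt0 alpha^-1 v0) ler01.
rewrite mul1r -powRrM mulVf ?gt_eqF// powRr1 ?(ltW v0)// => L.
rewrite EFinM -muleA; congr (_ * _)%E; rewrite EFinM; congr (_ * _)%E.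
by rewrite -L /laplace fineK//; apply: integrable_fin_num.
Qed.

(** The layer-cake identity at y = D 1, integrated over the sample space, gives G K = n! in the
    extended reals. Finiteness of G and K is not known beforehand: it follows, with positivity, from
    their being nonnegative with a finite nonzero product. *)
Lemma stable_inverse_moment n :
  (\int[P]_w ((D 1 w)^-1 `^ (n%:R * alpha))%:E =
   (n`!%:R / Gamma (n%:R * alpha + 1))%:E)%E /\ 0 < Gamma (n%:R * alpha + 1).
Proof.
pose G (b : R) := (\int[mu]_(x in `]0%R, +oo[) (x `^ b * expR (- x))%:E)%E.
have GE b : Gamma (b + 1) = fine (G b) by rewrite /Gamma /Rintegral addrK.
have G0 b : (0 <= G b)%E.
  by apply: integral_ge0 => x _; rewrite lee_fin mulr_ge0 ?powR_ge0 ?expR_ge0.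
have mG (b : R) : measurable_fun (`]0,
  +oo[ : set R) (fun x : R => (x `^ b * expR (- x))%:E).
  apply/measurable_EFinP; apply: measurable_funTS; apply: measurable_funM.
    exact: measurable_powR.
  by apply: measurableT_comp.
set K := (\int[P]_w _)%E.
have K0 : (0 <= K)%E by apply: integral_ge0 => w _; rewrite lee_fin powR_ge0.
suff GK : (G (n%:R * alpha)%R * K = n`!%:R%:E)%E.
  have f0 : (0 : R) < n`!%:R by rewrite ltr0n fact_gt0.
  rewrite GE; case: (G _) (G0 (n%:R * alpha)) GK => [g| |]//; last first.
    case: K K0 => [r| |]//; rewrite lee_fin le_eqVlt => /predU1P[<-|r0] _.
      by rewrite mule0 => -[] /esym/eqP; rewrite gt_eqF.
    by rewrite gt0_mulye.
  case: K K0 => [r| |]//; last first.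
    rewrite lee_fin => _; rewrite le_eqVlt => /predU1P[<-|g0].
      by rewrite mul0e => -[] /esym/eqP; rewrite gt_eqF.
    by rewrite gt0_muley.
  rewrite !lee_fin /= => r0 g0 [] e.
  have gp : 0 < g.
    rewrite lt_neqAle g0 andbT; apply/eqP => g0'.
    by move: f0; rewrite -e -g0' mul0r ltxx.
  by split => //; congr EFin; rewrite -e mulrC mulKf// gt_eqF.
(* The layer-cake identity covers the exponents n + 1; for exponent 0 both factors are 1. *)
case: n @K K0 => [|n] K K0.
  rewrite mul0r /K; under eq_integral do rewrite mul0r powRr0.
  rewrite integral_cst// -[RHS]mule1; congr (_ * _)%E; last first.
    by rewrite mul1e; exact: probability_setT.
  rewrite -(integral_gamma_fact R 0); apply: eq_integral => x _.
  by rewrite powRr0 expr0.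
rewrite -(integral_stable_exp n) /K -ge0_integralZl//; last 2 first.
- by apply/measurable_EFinP; exact: measurable_stable_inverse_pow.
- by move=> w _; rewrite lee_fin powR_ge0.
apply: ae_eq_integral => //.
- by apply: measurable_funeM; apply/measurable_EFinP; exact:
    measurable_stable_inverse_pow.
- exact: measurable_fun_fubini_tonelli_F.
(* The layer-cake identity requires y = D 1 > 0, which fails only on this null set. *)
exists [set w | D 1 w <= 0]; split.
- exact: measurable_le_set.
- exact: stable_gt0 hD.
move=> w /= h; rewrite leNgt; apply/negP => D0; apply: h => _.
rewrite -fubini_FE -integral_powR_expRN// -ge0_integralZr//; last 3 first.
- exact: mG.
- by move=> x _; rewrite lee_fin mulr_ge0 ?powR_ge0 ?expR_ge0.
- by rewrite lee_fin powR_ge0.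
apply: eq_integral => x; rewrite inE/= in_itv/= andbT => x0.
rewrite -EFinM; congr EFin; rewrite -powR_mulrn ?powR_ge0// -powRrM.
by rewrite powRM ?invr_ge0 ?(ltW x0)// [alpha * _]mulrC mulrAC.
Qed.

End stable_moment.

(** * Exchange of series and expectation *)

Section exponential_moment_series.
Context d (T : measurableType d) (R : realType) (P : probability T R).
Local Open Scope complex_scope.
Local Open Scope ring_scope.
Local Notation Re := complex.Re.
Local Notation Im := complex.Im.
Variables (W : T -> R) (kappa : R) (psi : R[i]) (c : nat -> R).
Hypothesis mW : measurable_fun setT W.
Hypothesis W_ge0 : forall w, 0 <= W w.
Hypothesis momentW : forall n, (\int[P]_w (W w ^+ n)%:E = (n`!%:R * c n)%:E)%E.

Let c_ge0 n : 0 <= c n.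
Proof.
have : (0 <= (n`!%:R * c n)%:E)%E.
  by rewrite -momentW; apply: integral_ge0 => w _; rewrite lee_fin exprn_ge0.
by rewrite lee_fin pmulr_rge0// ltr0n fact_gt0.
Qed.

Let integrable_pow n : P.-integrable setT (fun w => (W w ^+ n)%:E).
Proof.
apply/integrableP; split; first by apply/measurable_EFinP; exact:
  measurable_funX.
under eq_integral do rewrite gee0_abs ?lee_fin ?exprn_ge0//.
by rewrite momentW ltry.
Qed.

Let integrable_term (e : R) n : P.-integrable setT
  (fun w => (e * W w ^+ n / n`!%:R)%:E).
Proof.
have := integrableZl measurableT (e / n`!%:R) (integrable_pow n).
by congr (_.-integrable _ _); apply/funext => w /=; rewrite -EFinM mulrAC.
Qed.

Let integral_partial (e : nat -> R) n :
  (\int[P]_w (\sum_(i < n) (e i * W w ^+ i / i`!%:R))%:E =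
    (\sum_(i < n) e i * c i)%:E)%E.
Proof.
under eq_integral do rewrite -sumEFin.
rewrite integral_sum//; rewrite -sumEFin; apply: eq_bigr => i _.
transitivity (\int[P]_w ((e i / i`!%:R)%:E * (W w ^+ i)%:E))%E.
  by apply: eq_integral => w _; rewrite -EFinM mulrAC.
rewrite integralZl// momentW -EFinM mulrA; congr (_ * _)%:E.
by rewrite divfK// pnatr_eq0 -lt0n fact_gt0.
Qed.

Let mexpW (a : R) : measurable_fun setT (fun w => expR (a * W w)).
Proof. by apply: measurableT_comp => //; exact: measurable_funM. Qed.

Let exp_moment_le (a C : R) : 0 <= a ->
  (forall n, \sum_(i < n) a ^+ i * c i <= C) ->
  (\int[P]_w (expR (a * W w))%:E <= C%:E)%E.
Proof.
move=> a0 aC.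
pose g n w := (\sum_(i < n) (a ^+ i * W w ^+ i / i`!%:R))%:E.
have t0 i w : 0 <= a ^+ i * W w ^+ i / i`!%:R by rewrite !mulr_ge0 ?exprn_ge0
  ?invr_ge0.
have mg n : measurable_fun setT (g n).
  apply/measurable_EFinP; apply: measurable_sum => i; apply: measurable_funM =>
    //.
  by apply: measurable_funM => //; exact: measurable_funX.
have g0 n w : setT w -> (0 <= g n w)%E by move=> _; rewrite lee_fin; apply:
  sumr_ge0.
have ndg w : setT w -> {homo g^~ w : n m / (n <= m)%N >-> (n <= m)%E}.
  move=> _ n m nm; rewrite lee_fin
    -!(big_mkord xpredT (fun i => a ^+ i * W w ^+ i / i`!%:R)).
  by rewrite (big_cat_nat _ nm)//= lerDl sumr_ge0.
have h := cvg_monotone_convergence (mu := P) measurableT mg g0 ndg.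
have E : (fun w => limn (g ^~ w)) = (fun w => (expR (a * W w))%:E).
  apply/funext => w; apply/cvg_lim => //; apply: cvg_EFin; first exact: nearW.
  have /cvg_ex[l hl] := is_cvg_series_exp_coeff (a * W w).
  have -> : expR (a * W w) = l by rewrite /expR; apply/cvg_lim.
  apply: cvg_trans hl; apply: near_eq_cvg; near=> n.
  by rewrite /series/= big_mkord; apply: eq_bigr => i _; rewrite /exp_coeff/=
    exprMn.
rewrite E in h; apply: (cvge_le _ h); apply: nearW => n.
by rewrite integral_partial lee_fin.
Unshelve. all: by end_near. Qed.

Variables (f : R[i] -> R) (l : R).
Hypothesis fB : {morph f : x y / x - y}.
Hypothesis fM : forall z (r : R), f (z * r%:C) = f z * r.
Hypothesis f_le : forall z, `|f z| <= normc z.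
Variables (lR lI : R).
Hypothesis cvgR : series (fun n => Re (psi ^+ n) * c n) n @[n --> \oo] --> lR.
Hypothesis cvgI : series (fun n => Im (psi ^+ n) * c n) n @[n --> \oo] --> lI.
Hypothesis cvgf : series (fun n => f (psi ^+ n) * c n) n @[n --> \oo] --> l.
Hypothesis Re_psi : Re psi <= kappa.
Hypothesis integrable_kappa : P.-integrable setT
  (fun w => (expR (kappa * W w))%:E).

Let f_cvg (u : nat -> R[i]) z : normc (u n - z) @[n --> \oo] --> 0 ->
  f (u n) @[n --> \oo] --> f z.
Proof.
move=> h; apply/cvgrPdist_le => e e0.
move/cvgrPdist_le: h => /(_ _ e0); apply: filterS => n.
rewrite sub0r normrN ger0_norm ?normc_ge0// => /(le_trans _); apply.
by rewrite distrC -fB f_le.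
Qed.

Let f0 : f 0 = 0. Proof. by rewrite -[0 in LHS](subrr 0) fB subrr. Qed.

Let fD : {morph f : x y / x + y}.
Proof. by move=> x y; rewrite -[y in LHS]opprK fB -[- y]sub0r fB f0 sub0r opprK.
  Qed.

Let f_term (x : R) i : f ((x%:C * psi) ^+ i * (i`!%:R^-1)%:C) = f (psi ^+ i) * x
  ^+ i / i`!%:R.
Proof.
have -> : (x%:C * psi) ^+ i * (i`!%:R^-1)%:C = psi ^+ i * (x ^+ i / i`!%:R)%:C.
  by rewrite exprMn -rmorphXn rmorphM; ring.
by rewrite fM mulrA.
Qed.

(** The terms of the convergent real and imaginary series are bounded, and together they bound
    |psi|^n c_n. Hence both convergences serve, whichever part f extracts. *)
Let terms_bounded : exists B : R, forall n, normc psi ^+ n * c n <= B.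
Proof.
have bnd (u : nat -> R) (x : R) : series u n @[n --> \oo] --> x -> exists B : R,
  forall n, `|u n| <= B.
  move=> ux; have : u n @[n --> \oo] --> 0 by apply: cvg_series_cvg_0;
    apply/cvg_ex; exists x.
  move=> /cvgP/cvg_seq_bounded [M [_ hM]].
  by exists (M + 1) => n; apply: hM => //; rewrite ltrDl.
have [B1 h1] := bnd _ _ cvgR; have [B2 h2] := bnd _ _ cvgI.
exists (B1 + B2) => n; rewrite -normcX.
apply: le_trans (ler_wpM2r (c_ge0 n) (normc_le_ReIm _)) _.
rewrite mulrDl; apply: lerD.
  by have := h1 n; rewrite normrM (ger0_norm (c_ge0 n)).
by have := h2 n; rewrite normrM (ger0_norm (c_ge0 n)).
Qed.

Let mfcexp (r : R) : measurable_fun setT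
  (fun w => f (cexp ((r * W w)%:C * psi))).
Proof.
pose g n w := \sum_(i < n) (f (psi ^+ i) * r ^+ i * W w ^+ i / i`!%:R).
apply: (@measurable_fun_cvg _ _ _ _ g).
- move=> n; apply: measurable_sum => i; apply: measurable_funM => //.
  by apply: measurable_funM => //; exact: measurable_funX.
- move=> w _; have := f_cvg (cvg_exp_partial ((r * W w)%:C * psi)).
  apply: cvg_trans; apply: near_eq_cvg; near=> n.
  rewrite /exp_partial (big_morph f fD f0); apply: eq_bigr => i _.
  by rewrite f_term exprMn mulrA.
Unshelve. all: by end_near. Qed.

(** If B bounds |psi|^n c_n, then E exp(r |psi| W) <= B / (1 - r), and exp(r |psi| W) dominates all
    partial sums of the exponential series of r psi W. *)
Let series_radius (r : R) : 0 <= r < 1 ->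
  series (fun i => f (psi ^+ i) * c i * r ^+ i) n @[n --> \oo] -->
  \int[P]_w f (cexp ((r * W w)%:C * psi)).
Proof.
move=> /andP[r0 r1]; have [B hB] := terms_bounded.
pose a := r * normc psi.
have a0 : 0 <= a by rewrite mulr_ge0 ?normc_ge0.
have ia : P.-integrable setT (EFin \o (fun w => expR (a * W w))).
  apply/integrableP; split; first by apply/measurable_EFinP; exact: mexpW.
  under eq_integral do rewrite /= ger0_norm ?expR_ge0//.
  apply: le_lt_trans (ltry (B / (1 - r))); apply: exp_moment_le => // n.
  apply: (@le_trans _ _ (\sum_(i < n) r ^+ i * B)).
    apply: ler_sum => i _; rewrite exprMn -mulrA ler_wpM2l ?exprn_ge0//.
  have B0 : 0 <= B by apply: le_trans (hB 0%N); rewrite mulr_ge0 ?exprn_ge0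
    ?normc_ge0.
  rewrite -mulr_suml mulrC ler_wpM2l//.
  rewrite -[leRHS]mul1r ler_pdivlMr ?subr_gt0// mulrC.
  have -> : (1 - r) * (\sum_(i < n) r ^+ i) = 1 - r ^+ n.
    by rewrite -[RHS]opprB subrX1 -mulNr opprB.
  by rewrite lerBlDr lerDl exprn_ge0.
pose g n w := \sum_(i < n) (f (psi ^+ i) * r ^+ i * W w ^+ i / i`!%:R).
have mg n : measurable_fun setT (EFin \o g n).
  apply/measurable_EFinP; apply: measurable_sum => i; apply: measurable_funM =>
    //.
  by apply: measurable_funM => //; exact: measurable_funX.
have gcvg w : setT w -> (g n w)%:E @[n --> \oo] -->
  (f (cexp ((r * W w)%:C * psi)))%:E.
  move=> _; apply: cvg_EFin; first exact: nearW.
  have := f_cvg (cvg_exp_partial ((r * W w)%:C * psi)).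
  apply: cvg_trans; apply: near_eq_cvg; near=> n.
  rewrite /exp_partial (big_morph f fD f0); apply: eq_bigr => i _.
  by rewrite f_term exprMn mulrA.
have gle n w : setT w -> (`|(EFin \o g n) w| <=
  (EFin \o (fun w => expR (a * W w))) w)%E.
  move=> _; rewrite /= lee_fin.
  apply: (@le_trans _ _ (\sum_(i < n) (a * W w) ^+ i / i`!%:R)).
    apply: le_trans (ler_norm_sum _ _ _) _; apply: ler_sum => i _.
    rewrite !normrM normrV ?unitfE ?pnatr_eq0 -?lt0n ?fact_gt0// normr_nat.
    rewrite ler_wpM2r ?invr_ge0// !exprMn (ger0_norm (exprn_ge0 _ r0))
      (ger0_norm (exprn_ge0 _ (W_ge0 w))).
    rewrite ler_wpM2r ?exprn_ge0// mulrC ler_wpM2l ?exprn_ge0//.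
    by rewrite (le_trans (f_le _))// normcX.
  have hx : 0 <= a * W w by rewrite mulr_ge0.
  have /cvg_ex[y hy] := is_cvg_series_exp_coeff (a * W w).
  have -> : expR (a * W w) = y by rewrite /expR; apply/cvg_lim.
  have -> : \sum_(i < n) (a * W w) ^+ i / i`!%:R = series (exp_coeff (a * W w))
    n.
    by rewrite /series/= big_mkord; apply: eq_bigr => i _.
  have <- : limn (series (exp_coeff (a * W w))) = y by apply/cvg_lim.
  apply: nondecreasing_cvgn_le; last by apply/cvg_ex; exists y.
  apply: nondecreasing_series => i _ _; exact: exp_coeff_ge0.
have h : (\int[P]_w (g n w)%:E)%E @[n --> \oo] -->
    (\int[P]_w (f (cexp ((r * W w)%:C * psi)))%:E)%E.
  exact: (dominated_cvg measurableT mg gcvg _ ia gle).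
have iE : P.-integrable setT (EFin \o (fun w => f (cexp ((r * W w)%:C * psi)))).
  apply: (integrable_bounded_by (mfcexp r) ia) => w.
  apply: le_trans (f_le _) _; rewrite normc_cexp mulrC Re_mulrC ler_expR.
  rewrite /a mulrC -!mulrA ler_wpM2l// mulrC ler_wpM2r//.
  exact: le_trans (ler_norm _) (le_Re_normc _).
have hE : \int[P]_w f (cexp ((r * W w)%:C * psi)) =
    fine (\int[P]_w (f (cexp ((r * W w)%:C * psi)))%:E)%E by [].
rewrite -(fineK (integrable_fin_num measurableT iE)) in h.
move/fine_cvg : h; rewrite hE; apply: cvg_trans; apply: near_eq_cvg; near=> n.
have /= -> := integral_partial (fun i => f (psi ^+ i) * r ^+ i) n.
rewrite /series/= big_mkord.
by apply: eq_bigr => i _; rewrite mulrAC.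
Unshelve. all: by end_near. Qed.

Lemma exponential_moment_series : \int[P]_w f (cexp ((W w)%:C * psi)) = l.
Proof.
pose r m : R := 1 - m.+2%:R^-1.
have r01 m : 0 <= r m < 1.
  rewrite /r subr_ge0 invf_le1 ?ler1n// ltrBlDr ltrDl invr_gt0 ltr0n//.
have r1 : r m @[m --> \oo] --> (1 : R).
  rewrite -[X in _ --> X]subr0; apply: cvgB; first exact: cvg_cst.
  by have := @cvg_harmonic R; rewrite -cvg_shiftS.
have hA := abel_limit r01 r1 cvgf (fun m => series_radius (r01 m)).
apply: (cvg_unique _ _ hA) => /=; first exact: norm_hausdorff.
have i1 : P.-integrable setT (EFin \o (fun _ : T => 1 : R)).
  exact: finite_measure_integrable_cst.
have i2 : P.-integrable setT (EFin \o (fun w => 1 + expR (kappa * W w))).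
  by have := integrableD measurableT i1 integrable_kappa.
(* For Re psi < 0, the exponent e Re psi W may exceed kappa W; the summand 1 covers this case. *)
have fle (e : R) w : 0 <= e <= 1 -> `|f (cexp ((e * W w)%:C * psi))| <= 1 + expR
  (kappa * W w).
  move=> /andP[e0 e1].
  apply: le_trans (f_le _) _; rewrite normc_cexp mulrC Re_mulrC.
  have [p0|p0] := leP (Re psi) 0.
    rewrite -[leLHS]addr0 lerD ?expR_ge0// -[leRHS]expR0 ler_expR.
    by rewrite mulr_le0_ge0// mulr_ge0.
  rewrite -[leLHS]add0r lerD// ler_expR.
  apply: (@le_trans _ _ (Re psi * W w)).
    by rewrite ler_wpM2l ?(ltW p0)// ler_piMl.
  by rewrite ler_wpM2r.
have hlim w : setT w -> (f (cexp ((r m * W w)%:C * psi)))%:E @[m --> \oo] -->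
    (f (cexp ((W w)%:C * psi)))%:E.
  move=> _; apply: cvg_EFin; first exact: nearW.
  have hx : r m * W w @[m --> \oo] --> W w.
    by rewrite -[X in _ --> X]mul1r; apply: cvgM => //; exact: cvg_cst.
  have hR : Re ((r m * W w)%:C * psi) @[m --> \oo] --> Re ((W w)%:C * psi).
    rewrite [_ * psi]mulrC Re_mulrC; under eq_fun do rewrite mulrC Re_mulrC.
    by apply: cvgM => //; exact: cvg_cst.
  have hI : Im ((r m * W w)%:C * psi) @[m --> \oo] --> Im ((W w)%:C * psi).
    rewrite [_ * psi]mulrC Im_mulrC; under eq_fun do rewrite mulrC Im_mulrC.
    by apply: cvgM => //; exact: cvg_cst.
  have eR := continuous_cvg _ (@continuous_expR R _) hR.
  have cI := continuous_cvg _ (@continuous_cos R _) hI.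
  have sI := continuous_cvg _ (@continuous_sin R _) hI.
  apply: f_cvg; apply: cvg_normc0.
  - under eq_fun do rewrite ReB; apply: cvg_sub0.
    exact: (cvgM (eR _) (cI _)).
  - under eq_fun do rewrite ImB; apply: cvg_sub0.
    exact: (cvgM (eR _) (sI _)).
have h : (\int[P]_w (f (cexp ((r m * W w)%:C * psi)))%:E)%E @[m --> \oo] -->
    (\int[P]_w (f (cexp ((W w)%:C * psi)))%:E)%E.
  apply: (dominated_cvg measurableT _ hlim _ i2) => //.
  - by move=> m; apply/measurable_EFinP; exact: mfcexp.
  - move=> m w _; rewrite /= lee_fin fle//.
    by have /andP[-> /ltW ->] := r01 m.
have iE : P.-integrable setT (EFin \o (fun w => f (cexp ((W w)%:C * psi)))).
  apply: (integrable_bounded_by _ i2) => [|w].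
    by have := mfcexp 1; under eq_fun do rewrite mul1r.
  by have := fle 1 w; rewrite mul1r lexx ler01 => /(_ isT).
rewrite -(fineK (integrable_fin_num measurableT iE)) in h.
by move/fine_cvg : h.
Qed.

End exponential_moment_series.

(** * Mixtures of Skellam laws *)

Section product_probability.
Context d1 d2 (T1 : measurableType d1) (T2 : measurableType d2) (R : realType).
Variables (P1 : probability T1 R) (P2 : probability T2 R).

Let product_setT : (P1 \x P2)%E setT = 1%E.
Proof.
rewrite -setXTT product_measure1E// -[RHS]mule1.
by congr (_ * _)%E; exact: probability_setT.
Qed.

HB.instance Definition _ :=
  Measure_isProbability.Build _ _ _ (P1 \x P2)%E product_setT.

Definition product_probability : probability (T1 * T2)%type R := (P1 \x P2)%E.

End product_probability.

Section skellam_mixture.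
Context d d' (T : measurableType d) (T' : measurableType d') (R : realType).
Variables (P : probability T R) (Q : probability T' R).
Local Open Scope complex_scope.
Local Open Scope ring_scope.
Local Notation Re := complex.Re.
Local Notation Im := complex.Im.
Variables (k : nat) (lam mu : 'I_k -> R) (S : R -> T -> int).
Hypothesis hS : gsp P lam mu S.
Variables (Z : T -> int) (W : T' -> R).
Hypothesis mW : measurable_fun setT W.
Hypothesis W_ge0 : forall q, 0 <= W q.
Hypothesis mZ : forall h : int -> R, measurable_fun setT (fun w => h (Z w)).
Hypothesis mixture : forall h : int -> R, (forall z, 0 <= h z) ->
  (\int[P]_w (h (Z w))%:E = \int[Q]_q \int[P]_w (h (S (W q) w))%:E)%E.
Variable u : R[i].
Hypothesis u0 : u != 0.
Hypothesis uZ : (\int[P]_w (normc u ^ Z w)%:E < +oo)%E.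

(** The Skellam exponent at |u|, real by [skellam_exponent_real]: it governs E |u|^S(s) and serves
    as the kappa of the series argument. *)
Definition radial_exponent : R := Re (skellam_exponent lam mu (normc u)%:C).

Let nu0 : normc u != 0.
Proof. by apply: contra_neq u0; exact: eq0_normc. Qed.

Let nuz_ge0 z : 0 <= normc u ^ z. Proof. by rewrite exprz_ge0// normc_ge0. Qed.

Lemma normc_expz z : normc (u ^ z) = normc u ^ z.
Proof.
case: z => n; first exact: normcX.
by rewrite !NegzE -!exprnN normcV normcX.
Qed.

Lemma skellam_exponent_real (r : R) :
  skellam_exponent lam mu r%:C = (Re (skellam_exponent lam mu r%:C))%:C.
Proof.
have -> : skellam_exponent lam mu r%:C =
    (\sum_(j < k) (lam j * (r ^+ j.+1 - 1) + mu j * (r ^- j.+1 - 1)))%:C.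
  rewrite rmorph_sum; apply: eq_bigr => j _.
  by rewrite rmorphD !rmorphM !rmorphB rmorph1 fmorphV !rmorphXn.
by [].
Qed.

Let integral_radial s : 0 <= s ->
  (\int[P]_w (normc u ^ S s w)%:E = (expR (radial_exponent * s))%:E)%E.
Proof.
move=> s0; have nC : (normc u)%:C != 0 :> R[i] by rewrite fmorph_eq0.
have [i1 ER _] := skellam_gf hS nC s0.
have nn : normc (normc u)%:C = normc u by rewrite normc_real ger0_norm
  ?normc_ge0.
have realX z : Re ((normc u)%:C ^ z) = normc u ^ z.
  case: z => n.
    by rewrite -exprnP -rmorphXn.
  by rewrite NegzE -!exprnN -rmorphXn -fmorphV.
rewrite nn in i1; rewrite -(fineK (integrable_fin_num measurableT i1));
  congr EFin.
transitivity (\int[P]_w Re ((normc u)%:C ^ S s w)).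
  by apply: eq_Rintegral => w _; rewrite realX.
by rewrite ER skellam_exponent_real -rmorphM cexp_real mulrC.
Qed.

(** The mixture identity for |u|^z turns the finiteness of E |u|^Z into that of this exponential
    moment. *)
Lemma integrable_radial : Q.-integrable setT
  (fun q => (expR (radial_exponent * W q))%:E).
Proof.
apply/integrableP; split.
  by apply/measurable_EFinP; apply: measurableT_comp => //; exact:
    measurable_funM.
apply: le_lt_trans uZ; rewrite (mixture nuz_ge0).
rewrite le_eqVlt; apply/orP; left; apply/eqP; apply: eq_integral => q _.
by rewrite integral_radial//= ger0_norm ?expR_ge0.
Qed.

(** The mixture identity is given for nonnegative h, so it is applied to f(u^z) + |u|^z; the
    identity for |u|^z is then subtracted, all terms being finite. *)
Lemma mixture_gf (f : R[i] -> R) : (forall z, `|f z| <= normc z) ->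
  measurable_fun setT (fun q => f (cexp ((W q)%:C * skellam_exponent lam mu u)))
    ->
  (forall s, 0 <= s -> \int[P]_w f (u ^ S s w) = f
    (cexp (s%:C * skellam_exponent lam mu u))) ->
  \int[P]_w f (u ^ Z w) = \int[Q]_q f
    (cexp ((W q)%:C * skellam_exponent lam mu u)).
Proof.
move=> fle mf fS.
pose h z := f (u ^ z) + normc u ^ z.
have fz z : `|f (u ^ z)| <= normc u ^ z by rewrite -normc_expz fle.
have h0 z : 0 <= h z by rewrite /h -lerBlDr sub0r; have := fz z;
  rewrite ler_norml => /andP[].
have iU : P.-integrable setT (EFin \o (fun w => normc u ^ Z w)).
  apply/integrableP; split; first by apply/measurable_EFinP; exact:
    (mZ (fun z => normc u ^ z)).
  by under eq_integral do rewrite /= ger0_norm//.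
have iF : P.-integrable setT (EFin \o (fun w => f (u ^ Z w))).
  by apply: (integrable_bounded_by (mZ (fun z => f (u ^ z))) iU) => w; exact:
    fz.
have iK := integrable_radial.
have iS s : 0 <= s -> P.-integrable setT (EFin \o (fun w => normc u ^ S s w)).
  by move=> s0; have [] := skellam_gf hS u0 s0.
have iSf s : 0 <= s -> P.-integrable setT (EFin \o (fun w => f (u ^ S s w))).
  move=> s0; apply: (integrable_bounded_by _ (iS s s0)) => [|w]; last exact: fz.
  exact: (measurable_int_fun (fun z => f (u ^ z)) (measurable_skellam hS s0)).
have hE q : (\int[P]_w (h (S (W q) w))%:E =
    (f (cexp ((W q)%:C * skellam_exponent lam mu u)) + expR
      (radial_exponent * W q))%:E)%E.
  under eq_integral do rewrite EFinD.
  rewrite (integralD_EFin measurableT (iSf _ (W_ge0 q)) (iS _ (W_ge0 q))).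
  rewrite integral_radial// EFinD; congr (_ + _)%E.
  rewrite -fS// /Rintegral fineK//; exact: integrable_fin_num (iSf _ (W_ge0 q)).
have H1 := mixture h0; have H2 := mixture nuz_ge0.
have fQ q : `|f (cexp ((W q)%:C * skellam_exponent lam mu u))| <= expR
  (radial_exponent * W q).
  rewrite -(fS _ (W_ge0 q)).
  apply: le_trans (le_normr_Rintegral measurableT (iSf _ (W_ge0 q))) _.
  have -> : expR (radial_exponent * W q) = \int[P]_w (normc u ^ S (W q) w).
    by rewrite /Rintegral integral_radial.
  apply: le_Rintegral => //.
  - exact: integrable_norm (iSf _ (W_ge0 q)).
  - exact: iS.
have iQ : Q.-integrable setT
  (EFin \o (fun q => f (cexp ((W q)%:C * skellam_exponent lam mu u)))).
  by apply: (integrable_bounded_by mf iK) => q; exact: fQ.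
rewrite /Rintegral; congr fine.
have := H1; under [LHS]eq_integral do rewrite EFinD.
rewrite (integralD_EFin measurableT iF iU) H2.
under [X in (_ + X)%E = _]eq_integral do rewrite integral_radial//.
under [RHS]eq_integral do rewrite hE EFinD.
rewrite (integralD_EFin measurableT iQ iK).
have fin := integrable_fin_num measurableT iK.
move=> /(congr1 (fun x => (x - \int[Q]_q (expR (radial_exponent * W q))%:E)%E)).
by rewrite !addeK//.
Qed.

End skellam_mixture.

Section mixture_pgf.
Context d d' (T : measurableType d) (T' : measurableType d') (R : realType).
Variables (P : probability T R) (Q : probability T' R).
Local Open Scope complex_scope.
Local Open Scope ring_scope.
Local Notation Re := complex.Re.
Local Notation Im := complex.Im.
Variables (k : nat) (lam mu : 'I_k -> R) (S : R -> T -> int).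
Hypotheses (lam_ge0 : forall j, 0 <= lam j) (mu_ge0 : forall j, 0 <= mu j).
Hypothesis hS : gsp P lam mu S.
Variables (Z : T -> int) (W : T' -> R).
Hypothesis mW : measurable_fun setT W.
Hypothesis W_ge0 : forall q, 0 <= W q.
Hypothesis mZ : forall h : int -> R, measurable_fun setT (fun w => h (Z w)).
Hypothesis mixture : forall h : int -> R, (forall z, 0 <= h z) ->
  (\int[P]_w (h (Z w))%:E = \int[Q]_q \int[P]_w (h (S (W q) w))%:E)%E.
Variable u : R[i].
Hypothesis u0 : u != 0.
Hypothesis uZ : (\int[P]_w (normc u ^ Z w)%:E < +oo)%E.
Local Notation psi := (skellam_exponent lam mu u : R[i]).

(** Termwise, Re (u^j) <= |u|^j for positive and negative j, and the rates are nonnegative. *)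
Lemma Re_skellam_exponent_le : Re psi <= radial_exponent lam mu u.
Proof.
have leR (z : R[i]) : Re z <= normc z := le_trans (ler_norm _) (le_Re_normc z).
have Re_lM (c : R) (z : R[i]) : Re (c%:C * z) = c * Re z by rewrite mulrC
  Re_mulrC mulrC.
rewrite /radial_exponent /skellam_exponent !Re_sum; apply: ler_sum => j _.
rewrite !ReD !Re_lM !ReB; apply: lerD; apply: ler_wpM2l => //; apply: lerB =>
  //.
  by rewrite -rmorphXn /= -normcX.
by rewrite -rmorphXn -fmorphV /= -normcX -normcV.
Qed.

Lemma mixture_pgf (c : nat -> R) (lR lI : R) :
  (forall n, \int[Q]_q (W q ^+ n)%:E = (n`!%:R * c n)%:E)%E ->
  series (fun n => Re (psi ^+ n) * c n) n @[n --> \oo] --> lR ->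
  series (fun n => Im (psi ^+ n) * c n) n @[n --> \oo] --> lI ->
  \int[P]_w Re (u ^ Z w) = lR /\ \int[P]_w Im (u ^ Z w) = lI.
Proof.
move=> mom hR hI.
have iK := integrable_radial hS mW W_ge0 mixture u0 uZ.
have mE : measurable_fun setT (fun q => expR (W q * Re psi)).
  by apply: measurableT_comp => //; exact: measurable_funM.
have mcos : measurable_fun setT (fun q => cos (W q * Im psi)).
  apply: (measurableT_comp (continuous_measurable_fun (@continuous_cos R))).
  exact: measurable_funM.
have msin : measurable_fun setT (fun q => sin (W q * Im psi)).
  apply: (measurableT_comp (continuous_measurable_fun (@continuous_sin R))).
  exact: measurable_funM.
split.
- rewrite (mixture_gf hS mW W_ge0 mZ mixture u0 uZ (@le_Re_normc R)).
  + apply: (exponential_moment_series mW W_ge0 mom (@ReB R) (@Re_mulrC R)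
      (@le_Re_normc R) hR hI hR Re_skellam_exponent_le iK).
  + have := measurable_funM mE mcos; apply: eq_measurable_fun => q _ /=.
    by rewrite [_ * psi]mulrC Re_mulrC Im_mulrC ![_ * W q]mulrC.
  + by move=> s s0; have [] := skellam_gf hS u0 s0.
- rewrite (mixture_gf hS mW W_ge0 mZ mixture u0 uZ (@le_Im_normc R)).
  + apply: (exponential_moment_series mW W_ge0 mom (@ImB R) (@Im_mulrC R)
      (@le_Im_normc R) hR hI hI Re_skellam_exponent_le iK).
  + have := measurable_funM mE msin; apply: eq_measurable_fun => q _ /=.
    by rewrite [_ * psi]mulrC Re_mulrC Im_mulrC ![_ * W q]mulrC.
  + by move=> s s0; have [] := skellam_gf hS u0 s0.
Qed.

End mixture_pgf.

(** * The fractional process as a mixture *)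

Section expectation_of_process.
Context d (T : measurableType d) (R : realType) (P : probability T R).
Variables (X : R -> T -> int).
Hypothesis mX : forall s, 0 <= s -> measurable_fun setT
  (fun w => (X s w)%:~R : R).
Hypothesis rX : right_constant X.

Lemma measurable_expectation_process (h : int -> R) : (forall z, 0 <= h z) ->
  measurable_fun setT (fun y : R => \int[P]_w (h (X (Num.max y 0) w))%:E)%E.
Proof.
move=> h0.
have mH s : 0 <= s -> measurable_fun setT (fun w => h (X s w)).
  by move=> s0; apply: measurable_int_fun; exact: mX.
have rH w s : 0 <= s -> h (X s' w) @[s' --> s^'+] --> h (X s w).
  move=> s0; apply: cvg_near_cst; have := rX w s0.
  by apply: filterS => s' ->.
pose F (z : (T * R)%type) := (h (X (Num.max z.2 0) z.1))%:E.
have mF : measurable_fun setT F.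
  by apply/measurable_EFinP; exact: (measurable_right_continuous mH rH).
have F0 z : (0 <= F z)%E by rewrite lee_fin.
exact: (measurable_fun_fubini_tonelli_G (m1 := P) F mF F0).
Qed.

End expectation_of_process.

Section fractional_process.
Context d (T : measurableType d) (R : realType) (P : probability T R).
Variables (alpha : R) (k : nat) (lam mu : 'I_k -> R) (S Sa : R -> T -> int).
Variable (D : R -> T -> R).
Hypothesis alpha_gt0 : 0 < alpha.
Hypothesis hS : gsp P lam mu S.
Hypothesis hD : stable_subordinator P alpha D.
Hypothesis indep : independent_processes P (fun t w => (S t w)%:~R)
  (inverse_process D).
Hypothesis SaE : forall t w, 0 <= t -> Sa t w = S (inverse_process D t w) w.
Local Notation Y := (inverse_process D).

Let mS := measurable_skellam hS.
Let rS := right_constant_skellam hS.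
Let Y0 t w : 0 <= Y t w := inverse_process_ge0 D t w.
Let mY t : measurable_fun setT (Y t) :=
  measurable_inverse_process (stable_mono hD) (stable_measurable hD) t.

Lemma measurable_fractional t : 0 <= t -> measurable_fun setT
  (fun w => (Sa t w)%:~R : R).
Proof.
move=> t0; have := measurable_process_at mS rS (mY t) (Y0 t)
  (fun z : int => z%:~R : R).
by apply: eq_measurable_fun => w _; rewrite SaE.
Qed.

(** Just after t, the time Y t' is either Y t itself or a point slightly to its right, where S has
    kept its value. *)
Lemma right_constant_fractional : right_constant Sa.
Proof.
move=> w t t0; have [e/= e0 he] := rS w (Y0 t w).
have := inverse_process_right_continuous D w t e0; apply: filter_app; near=> t'.
have tt' : t < t' by near: t'; exact: nbhs_right_gt.
rewrite !SaE ?(ltW (le_lt_trans t0 tt'))// => /andP[].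
rewrite le_eqVlt => /predU1P[->//|lt1 lt2]; apply: he => //=.
by rewrite distrC gtr0_norm ?subr_gt0// ltrBlDl.
Unshelve. all: by end_near. Qed.

(** Conditioning on Y leaves the mean of a function of Y alone, so only the law of Y matters, and
    [inverse_stable_tails] identifies it. *)
Lemma fractional_mixture t (h : int -> R) : 0 <= t -> (forall z, 0 <= h z) ->
  (\int[P]_w (h (Sa t w))%:E =
   \int[P]_w1 \int[P]_w (h (S ((t / D 1 w1) `^ alpha) w))%:E)%E.
Proof.
move=> t0 h0.
transitivity (\int[P]_w (h (S (Y t w) w))%:E)%E.
  by apply: eq_integral => w _; rewrite SaE.
rewrite (ge0_integral_process_at mS rS (mY t) (Y0 t) _ h0); last first.
  move=> A B hA mB; apply: indep => //; apply: sub_sigma_algebra.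
  by exists t, B.
pose F y := (\int[P]_w (h (S (Num.max y 0) w))%:E)%E.
transitivity (\int[P]_w F (Y t w))%E.
  by apply: eq_integral => w _; rewrite /F max_l.
rewrite (ge0_integral_eq_tails (mY t) (measurable_stable_ratio hD t)
  (fun x => inverse_stable_tails alpha_gt0 hD x t0)).
- by apply: eq_integral => w _; rewrite /F max_l// powR_ge0.
- exact: (measurable_expectation_process P mS rS h0).
- by move=> y; apply: integral_ge0 => w _; rewrite lee_fin.
Qed.

End fractional_process.

(** * Complex series and the final assembly *)

Section complex_series.
Variable R : realType.
Local Open Scope complex_scope.
Local Open Scope ring_scope.
Local Notation Re := complex.Re.
Local Notation Im := complex.Im.

Lemma cvg_cplx_normc (s : nat -> cplx R) (A : cplx R) :
  s n @[n --> \oo] --> A -> normc ((s n : R[i]) - A) @[n --> \oo] --> (0 : R).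
Proof.
move=> sA; apply/cvgrPdist_le => e e0.
have e0' : (0 : cplx R) < (e%:C : R[i]) by rewrite -[0]/(0%:C) ltcR.
move/cvgrPdist_le : sA => /(_ _ e0'); apply: filterS => n.
rewrite -[`|A - s n|]/((normc ((A : R[i]) - s n))%:C) lecR.
by rewrite sub0r normrN ger0_norm ?normc_ge0// -normcN opprB.
Qed.

Lemma cvg_series_ReIm (z : R[i]) (c : nat -> R) (a : nat -> cplx R) :
  (forall n, a n = z ^+ n * (c n)%:C :> R[i]) -> cvgn (series a) ->
  series (fun n => Re (z ^+ n) * c n) n @[n --> \oo] -->
    Re (limn (series a) : R[i]) /\
  series (fun n => Im (z ^+ n) * c n) n @[n --> \oo] -->
    Im (limn (series a) : R[i]).
Proof.
move=> aE /cvg_cplx_normc h; split.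
- apply: cvg_trans (cvg_Re_normc h); apply: near_eq_cvg; near=> n.
  rewrite /series/= (Re_sum (R := R)); apply: eq_bigr => i _.
  by rewrite -Re_mulrC -aE.
- apply: cvg_trans (cvg_Im_normc h); apply: near_eq_cvg; near=> n.
  rewrite /series/= (Im_sum (R := R)); apply: eq_bigr => i _.
  by rewrite -Im_mulrC -aE.
Unshelve. all: by end_near. Qed.

End complex_series.

Lemma Gamma_fact (R : realType) n : Gamma (n%:R * 1 + 1) = n`!%:R :> R.
Proof.
rewrite /Gamma /Rintegral mulr1 addrK.
rewrite (_ : n`!%:R = fine (n`!%:R%:E)%E :> R)// -(integral_gamma_fact R n).
congr fine; apply: eq_integral => x; rewrite inE/= in_itv/= andbT => x0.
by rewrite powR_mulrn// ltW.
Qed.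

Theorem theorem3p2 (d : measure_display) (T : measurableType d) (R : realType)
    (P : probability T R) (alpha : R) (k : nat) (lam mu : 'I_k -> R)
    (Sa : R -> T -> int) (f : R -> R) (D : R -> T -> R)
    (halpha : 0 < alpha <= 1) (hk : (1 <= k)%N)
    (hlam : forall j, 0 < lam j) (hmu : forall j, 0 < mu j)
    (hSa : gfsp P alpha lam mu Sa)
    (hD : levy_subordinator P f D)
    (hindep : independent_processes P (fun t w => (Sa t w)%:~R) D)
    (hmoments : forall t r : R, 0 <= t -> 0 < r ->
      ('E_P[fun w => (D t w `^ r)%R] < +oo)%E)
    (t : R) (ht : 0 <= t) (u : cplx R) (hu : `|u| <= 1) (hu0 : u != 0) :
  let Z := fun w => Sa (D t w) w in
  let a : nat -> cplx R := fun n =>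
    skellam_exponent lam mu u ^+ n
      / real_complex R (Gamma (n%:R * alpha + 1))
      * real_complex R (fine 'E_P[fun w => (D t w `^ (n%:R * alpha))%R]) in
  pgf_exists P Z u ->
  cvgn (series a) ->
  pgf P Z u = \big[+%R/0]_(0 <= n <oo) a n.
Proof.
move=> Z a hpgf cvga.
have [alpha0 _] := andP halpha.
have [_ [mD _ _ _ _] D_mono _] := hD.
have D0 w : 0 <= D t w by have [] := D_mono w t t ht (lexx t).
pose m n := fine 'E_P[fun w => (D t w `^ (n%:R * alpha))%R]%E.
pose g n : R := Gamma (n%:R * alpha + 1).
have momD n : (\int[P]_w (D t w `^ (n%:R * alpha))%:E = (m n)%:E)%E.
  rewrite /m unlock fineK// ge0_fin_numE; last first.
    by apply: integral_ge0 => w _; rewrite lee_fin powR_ge0.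
  (* The moment hypothesis concerns positive exponents; for n = 0 the integrand is the constant
     1. *)
  case: n => [|n]; last first.
    by have := hmoments t (n.+1%:R * alpha) ht; rewrite unlock; apply;
      rewrite mulr_gt0.
  under eq_integral do rewrite mul0r powRr0.
  by rewrite integral_cst// mul1e (le_lt_trans (probability_le1 _ _))// ltry.
have [hR hI] : series (fun n =>
  complex.Re ((skellam_exponent lam mu u : R[i]) ^+ n) * (m n / g n)) n
      @[n --> \oo] --> complex.Re (limn (series a) : R[i]) /\
   series (fun n => complex.Im ((skellam_exponent lam mu u : R[i]) ^+ n) *
     (m n / g n)) n
      @[n --> \oo] --> complex.Im (limn (series a) : R[i]).
  apply: cvg_series_ReIm => // n.
  by rewrite /a -mulrA; congr (_ * _); rewrite mulrC rmorphM fmorphV.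
have uZ : (\int[P]_w (normc (u : R[i]) ^ Z w)%:E < +oo)%E.
  by move: hpgf; rewrite /pgf_exists unlock.
suff [ER EI] : \int[P]_w complex.Re ((u : R[i]) ^ Z w) = complex.Re
  (limn (series a) : R[i]) /\
    \int[P]_w complex.Im ((u : R[i]) ^ Z w) = complex.Im
      (limn (series a) : R[i]).
  apply/eqP; rewrite eq_complex /=; apply/andP.
  by rewrite !expectation_Rintegral; split; apply/eqP.
have indepD A B : process_sigma (fun s w => (Sa s w)%:~R : R) A ->
    measurable B -> P (A `&` D t @^-1` B) = (P A * P (D t @^-1` B))%E.
  move=> hA mB; apply: hindep => //; apply: sub_sigma_algebra.
  by exists t, B.
have [S hS [[a1 SaE]|[_ [Da [hDa indepS SaE]]]]] := hSa.
  have mSa s : 0 <= s -> measurable_fun setT (fun w => (Sa s w)%:~R : R).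
    move=> s0; apply: eq_measurable_fun (measurable_skellam hS s0) => w _.
    by rewrite SaE.
  have rSa : right_constant Sa.
    move=> w s s0; have := right_constant_skellam hS w s0; apply: filter_app;
      near=> s'.
    have ss' : s < s' by near: s'; exact: nbhs_right_gt.
    by rewrite !SaE// ltW// (le_lt_trans s0).
  apply: (mixture_pgf (Q := P) (W := D t) (fun j => ltW (hlam j))
    (fun j => ltW (hmu j))
    hS (mD t ht) D0 _ _ hu0 uZ _ hR hI).
  - exact: (measurable_process_at mSa rSa (mD t ht) D0).
  - move=> h h0; rewrite (ge0_integral_process_at mSa rSa (mD t ht) D0 indepD
      h0).
    by apply: eq_integral => w2 _; apply: eq_integral => w1 _; rewrite SaE.
  (* For alpha = 1, the value Gamma(n + 1) = n! cancels the factorial and leaves the n-th moment of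
     D(t). *)
  - move=> n; rewrite /g a1 Gamma_fact mulrC divfK; last by rewrite pnatr_eq0
      -lt0n fact_gt0.
    rewrite -momD; apply: eq_integral => w _.
    by rewrite a1 mulr1 powR_mulrn.
have mSa := measurable_fractional hS hDa SaE.
have rSa := right_constant_fractional hS SaE.
have mDa' := measurable_stable_inverse_pow hDa.
pose W (z : (T * T)%type) : R := (D t z.1 / Da 1 z.2) `^ alpha.
have WE z : W z = D t z.1 `^ alpha * (Da 1 z.2)^-1 `^ alpha.
  by rewrite /W powRM// invr_ge0 (stable_ge0 hDa).
have mW : measurable_fun setT W.
  have : measurable_fun setT
    (fun z : (T * T)%type => D t z.1 `^ alpha * (Da 1 z.2)^-1 `^ alpha).
    apply: measurable_funM; last exact: (measurableT_comp (mDa' alpha)).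
    apply: (measurableT_comp (measurable_powR alpha)).
    exact: (measurableT_comp (mD t ht)).
  by apply: eq_measurable_fun => z _; rewrite WE.
have W0 z : 0 <= W z by exact: powR_ge0.
apply: (mixture_pgf (Q := product_probability P P) (W := W)
  (fun j => ltW (hlam j)) (fun j => ltW (hmu j))
    hS mW W0 _ _ hu0 uZ _ hR hI).
- exact: (measurable_process_at mSa rSa (mD t ht) D0).
(* Conditioning on D(t), then on the inverse process at the now fixed time D(t), produces the double
   integral over P x P. *)
- move=> h h0; rewrite (ge0_integral_process_at mSa rSa (mD t ht) D0 indepD h0).
  pose F (y : R) := (\int[P]_w (h (S (Num.max y 0) w))%:E)%E.
  have mF : measurable_fun setT F.
    exact: (measurable_expectation_process P (measurable_skellam hS)
      (right_constant_skellam hS) h0).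
  have F0 y : (0 <= F y)%E by apply: integral_ge0 => w _; rewrite lee_fin.
  transitivity (\int[(P \x P)%E]_z F (W z))%E; last first.
    by apply: eq_integral => z _; rewrite /F max_l.
  have mFW : measurable_fun setT (fun z => F (W z)) by exact: measurableT_comp.
  rewrite (fubini_tonelli1 _ mFW)//.
  apply: eq_integral => w2 _;
    rewrite (fractional_mixture alpha0 hS hDa indepS SaE)//.
  by apply: eq_integral => w1 _; rewrite /F /= max_l.
- move=> n; have [momV g0] := stable_inverse_moment alpha0 hDa n.
  have mWn : measurable_fun setT (fun z => (W z ^+ n)%:E).
    by apply/measurable_EFinP; exact: measurable_funX.
  transitivity (\int[(P \x P)%E]_z (W z ^+ n)%:E)%E; first by [].
  rewrite (fubini_tonelli1 _ mWn); last by move=> z; rewrite lee_fin exprn_ge0.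
  rewrite /fubini_F.
  (* On the product space E W^n factors into E D(t)^(n alpha) and E Da(1)^(- n alpha) = n! / Gamma(n
     alpha + 1). *)
  transitivity (\int[P]_w2 ((D t w2 `^ (n%:R * alpha))%:E *
    (n`!%:R / g n)%:E))%E.
    apply: eq_integral => w2 _; rewrite -momV -ge0_integralZl//; last 3 first.
    + by apply/measurable_EFinP; exact: mDa'.
    + by move=> w _; rewrite lee_fin powR_ge0.
    + by rewrite lee_fin powR_ge0.
    apply: eq_integral => w1 _; rewrite WE exprMn -!powR_mulrn ?powR_ge0//
      -!powRrM.
    by rewrite EFinM ![alpha * _]mulrC.
  have gn0 : (0 <= (n`!%:R / g n)%:E)%E by rewrite lee_fin divr_ge0// ltW.
  rewrite ge0_integralZr//; last 2 first.
  + by apply/measurable_EFinP; apply: (measurableT_comp (measurable_powR _));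
      exact: (mD t ht).
  + by move=> w _; rewrite lee_fin powR_ge0.
  by rewrite momD -EFinM; congr EFin; rewrite mulrC mulrAC mulrA.
Unshelve. all: by end_near. Qed.
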